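(* Fix $\delta\in(0,1)$ and let $D\in\{-1,0,1\}^{m\times n}$ denote the incidence matrix of the two-dimensional $N\times N$ grid, $n=N^2$. Let $\theta^*\in\mathbb{R}^n$ and $y=\theta^*+\varepsilon$ with $\varepsilon\sim\mathcal N(0,\sigma^2I_n)$. Then there exist numerical constants $C,c>0$ such that the TV denoiser $$\hat\theta\in\operatorname*{argmin}_{\theta\in\mathbb{R}^n}\ \frac1n\|\theta-y\|_2^2+\lambda\|D\theta\|_1\qquad\text{with}\qquad \lambda=c\,\sigma\sqrt{(\log n)\log(en/\delta)}/n$$ satisfies $$\frac1n\|\hat\theta-\theta^*\|_2^2\le\inf_{\bar\theta\in\mathbb{R}^n,\ T\subseteq[m]}\Big\{\frac1n\|\bar\theta-\theta^*\|_2^2+4\lambda\|(D\bar\theta)_{T^c}\|_1+\frac{C\sigma^2}{n}\big(|T|(\log n)\log(en/\delta)+\log(e/\delta)\big)\Big\}$$ with probability at least $1-2\delta$. In particular, it yields $$\mathrm{MSE}(\hat\theta)\lesssim\frac{\sigma\|D\theta^*\|_1\wedge\sigma^2\|D\theta^*\|_0}{n}\log^2(en/\delta),$$ where $\|D\theta^*\|_0$ denotes the number of nonzero components of $D\theta^*$.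
   Context: $\mathrm{MSE}(\hat\theta)=\frac1n\|\hat\theta-\theta^*\|_2^2$. The two-dimensional $N\times N$ grid has vertex set $[N]^2$ (identified with $[n]$, $n=N^2$, where $[k]=\{1,\dots,k\}$), and two vertices are joined by an edge iff their difference is $\pm(1,0)$ or $\pm(0,1)$; $m$ is its number of edges. The incidence matrix $D$ has one row per edge $(i,j)$, with entry $1$ at $\min(i,j)$, $-1$ at $\max(i,j)$ and $0$ elsewhere. For $x\in\mathbb{R}^m$ and $T\subseteq[m]$, $x_T$ has coordinates $x_j$ for $j\in T$ and $0$ otherwise; $T^c=[m]\setminus T$. $a\wedge b=\min(a,b)$. The notation $\lesssim$ means that the left-hand side is bounded by the right-hand side up to a numerical constant.
   Formalization: The final MSE display fails for θ*=0 (right side 0, but MSE ≥ (mean of ε)² > 0 a.s.). It is proved with the dropped term σ² log(e/δ)/n added for every θ*, and as displayed when σ log(e/δ) ≤ ‖Dθ*‖₁ log²(en/δ). N ≥ 1 and σ > 0 are assumed. *)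

(* Defs.v *)
From HB Require Import structures.
From mathcomp Require Import all_boot all_order all_algebra.
From mathcomp Require Import all_classical all_reals all_analysis.

Set Implicit Arguments.
Unset Strict Implicit.
Unset Printing Implicit Defensive.

Import Order.TTheory GRing.Theory Num.Theory.

Local Open Scope classical_set_scope.
Local Open Scope ring_scope.

(* The N x N grid, its vertices being numbered row by row: vertex
   v : 'I_(N ^ 2) sits at the point (v %/ N, v %% N) of {0, ..., N - 1}^2. *)
Definition grid_adj (N : nat) (u v : 'I_(N ^ 2)) : bool :=
  ((u %/ N)%N%:Z - (v %/ N)%N%:Z, (u %% N)%N%:Z - (v %% N)%N%:Z)
    \in [:: (1, 0); (- 1, 0); (0, 1); (0, - 1)].

(* An edge is listed once, as the pair (min, max) of its endpoints. *)
Definition grid_edges (N : nat) : {set 'I_(N ^ 2) * 'I_(N ^ 2)} :=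
  [set e : 'I_(N ^ 2) * 'I_(N ^ 2) | (e.1 < e.2)%N && grid_adj e.1 e.2]%SET.

Definition incidence_mx (R : pzRingType) (n : nat) (E : {set 'I_n * 'I_n}) :
    'M[R]_(#|E|, n) :=
  \matrix_(k, v) if v == (enum_val k).1 then 1
                 else if v == (enum_val k).2 then - 1 else 0.

Definition grid_incidence (R : pzRingType) (N : nat) :
    'M[R]_(#|grid_edges N|, N ^ 2) :=
  incidence_mx R (grid_edges N).

Definition sqnorm2 (R : realType) (n : nat) (x : 'cV[R]_n) : R :=
  \sum_i x i 0 ^+ 2.

Definition norm1 (R : realType) (n : nat) (x : 'cV[R]_n) : R :=
  \sum_i `|x i 0|.

Definition norm0 (R : realType) (n : nat) (x : 'cV[R]_n) : nat :=
  #|[set i | x i 0 != 0]%SET|.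

Definition vrestrict (R : realType) (n : nat) (T : {set 'I_n}) (x : 'cV[R]_n) :
    'cV[R]_n :=
  \col_i if i \in T then x i 0 else 0.

Definition MSE (R : realType) (n : nat) (theta_hat theta : 'cV[R]_n) : R :=
  n%:R^-1 * sqnorm2 (theta_hat - theta).

Definition argmin (R : realType) (X : Type) (f : X -> R) : set X :=
  [set x | forall x', f x <= f x'].

Definition tv_objective (R : realType) (m n : nat) (D : 'M[R]_(m, n))
    (lambda : R) (y theta : 'cV[R]_n) : R :=
  n%:R^-1 * sqnorm2 (theta - y) + lambda * norm1 (D *m theta).

Definition mutually_independent (R : realType) (d : measure_display)
    (Omega : measurableType d) (P : probability Omega R) (I : finType)
    (X : I -> {RV P >-> R}) : Prop :=
  forall B : I -> set R, (forall i, measurable (B i)) ->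
    P (\bigcap_(i in [set: I]) (X i @^-1` B i)) =
    (\prod_(i : I) P (X i @^-1` B i))%E.

(* Law N(0, sigma^2 I); normal_prob takes the standard deviation, and is the
   Gaussian law only when it is nonzero. *)
Definition isotropic_gaussian (R : realType) (d : measure_display)
    (Omega : measurableType d) (P : probability Omega R) (I : finType)
    (sigma : R) (X : I -> {RV P >-> R}) : Prop :=
  mutually_independent X /\
  forall (i : I) (B : set R), measurable B ->
    distribution P (X i) B = normal_prob 0 sigma B.

(* P is only meaningful on measurable sets, so "E has probability at least p"
   is read as: E contains an event of probability at least p. *)
Definition with_prob_at_least (R : realType) (d : measure_display)
    (Omega : measurableType d) (P : probability Omega R) (p : R)
    (E : set Omega) : Prop :=
  exists A : set Omega, [/\ measurable A, A `<=` E & (p%:E <= P A)%E].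

(* Main.v *)
Require Import Defs.
From HB Require Import structures.
From mathcomp Require Import all_boot all_order all_algebra.
From mathcomp Require Import all_classical all_reals all_analysis.
From mathcomp Require Import measurable_realfun.
From mathcomp Require Import ring lra zify.

Set Implicit Arguments.
Unset Strict Implicit.
Unset Printing Implicit Defensive.

Import Order.TTheory GRing.Theory Num.Theory.

Local Open Scope classical_set_scope.
Local Open Scope ring_scope.

(** The estimator is a penalised least squares estimator, so its error is
    governed by the noise term <eps, x> with x = theta_hat - theta_bar.  The
    whole proof rests on an identity
      x = mean(x) + S (D x)
    for a fixed matrix S (flow_mx), which splits this term into
      mean(x) * (sum of eps) + <S^T eps, D x>.
    The first part is harmless: by Cauchy-Schwarz it costs
    (sum of eps)^2 / n, of order sigma^2 log(e / delta), plus a fraction of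
    |x|_2^2.  The second is at most |S^T eps|_oo |D x|_1.  As soon as
    lambda n / 2 exceeds |S^T eps|_oo it is compensated by the penalty outside
    T, and on T, where |(D x)_T|_1 <= sqrt |T| |D x|_2 <= sqrt (8 |T|) |x|_2
    because a vertex has at most four neighbours, it costs n lambda^2 |T| plus
    another fraction of |x|_2^2.  These fractions are absorbed by the strong
    convexity of the squared loss (tv_oracle_inequality).

    It remains to see that lambda of the announced size is enough, that is,
    that the columns of S have squared Euclidean norm O(log n): Gaussian tails
    and a union bound over the at most 2 n edges then give
    |S^T eps|_oo = O(sigma sqrt (log n log (e n / delta))).
    Row v of S must be a unit flow from the vertex v to the uniform
    distribution on the grid.  The pseudo-inverse of D is the textbook choice;
    here the mass is spread over larger and larger blocks instead.  At scale j
    it is uniform on a block of side about 2^j around v; to pass to scale j + 1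
    it is spread along one coordinate, then along the other.  The mass crossing
    a given edge during that stage is at most 2^-j, and only about 4^j vertices
    v use the edge.  So each of the log N stages contributes O(1) to the sum of
    the squares of a column, and the cross terms between stages form geometric
    sums (multiscale_sqsum_le, flow_mx_col_sqsum_le).

    Independence enters only through E prod f_i(X_i) = prod E f_i(X_i) for
    nonnegative f_i (independent_integral_prod), which yields the Laplace
    transform of a linear form in the noise and hence, with Chernoff's bound,
    its Gaussian tail (gaussian_tail).

    The second and third bounds are the oracle inequality at
    theta_bar = theta, with T empty for the l1 rate and T the support of
    D theta for the l0 rate. *)

(** * Nested interval partitions *)

(** Index of the interval containing a, when [0, N) is cut into intervals of
    length 2^j and the incomplete last one is merged with its predecessor.  The
    merging makes the lengths comparable to 2^j for every N, not only for powers
    of two, while keeping the partitions nested. *)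
Definition block (N j a : nat) : nat := minn (a %/ 2 ^ j) (N %/ 2 ^ j).-1.

Lemma leq_block N j a b : (a <= b)%N -> (block N j a <= block N j b)%N.
Proof. by move=> ab; rewrite /block; have := leq_div2r (2 ^ j) ab; lia. Qed.

Lemma block_finest N a : (a < N)%N -> block N 0 a = a.
Proof. by rewrite /block expn0 !divn1; lia. Qed.

Lemma block_coarsest N j a : (N < 2 ^ j.+1)%N -> block N j a = 0%N.
Proof.
move=> Nj; rewrite /block; suff -> : ((N %/ 2 ^ j).-1 = 0)%N by rewrite minn0.
suff : (N %/ 2 ^ j < 2)%N by lia.
by rewrite ltn_divLR ?expn_gt0// -expnS.
Qed.

(** The block at scale j + 1 depends on a only through its block at scale j;
    this is what makes the partitions nested. *)
Lemma blockS N j a : (a < N)%N -> (2 ^ j.+1 <= N)%N ->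
  block N j.+1 a = minn (block N j a %/ 2) (N %/ 2 ^ j.+1).-1.
Proof.
move=> aN jN; rewrite /block expnSr !divnMA.
have : (2 <= N %/ 2 ^ j)%N by rewrite leq_divRL ?expn_gt0// mulnC -expnSr.
have : (a %/ 2 ^ j <= N %/ 2 ^ j)%N by rewrite leq_div2r// ltnW.
move: (a %/ _)%N (N %/ _)%N => u q; lia.
Qed.

Lemma block_nested N j a b : (a < N)%N -> (b < N)%N -> (2 ^ j.+1 <= N)%N ->
  block N j a = block N j b -> block N j.+1 a = block N j.+1 b.
Proof. by move=> aN bN jN e; rewrite !blockS// e. Qed.

Definition block_size (N j a : nat) : nat :=
  count (fun s => block N j s == block N j a) (iota 0 N).

Lemma block_size_ge N j a : (2 ^ j <= N)%N -> (2 ^ j <= block_size N j a)%N.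
Proof.
move=> jN; have j0 : (0 < 2 ^ j)%N by rewrite expn_gt0.
rewrite -[leqLHS](size_iota (block N j a * 2 ^ j)) /block_size -size_filter.
apply: uniq_leq_size => [|s]; first exact: iota_uniq.
rewrite mem_iota mem_filter mem_iota add0n => /andP[s1 s2].
have q1 : (0 < N %/ 2 ^ j)%N by rewrite divn_gt0.
have c_lt : (block N j a < N %/ 2 ^ j)%N by rewrite /block; lia.
have sq : (s %/ 2 ^ j = block N j a)%N.
  apply/eqP; rewrite eqn_leq leq_divRL// s1 andbT -ltnS ltn_divLR//.
  by rewrite mulSn addnC.
apply/andP; split.
  by rewrite {1}/block sq; move: (block N j a) (N %/ _)%N c_lt => c q; lia.
rewrite /= (leq_trans s2)// addnC -mulSn (leq_trans _ (leq_divM N (2 ^ j)))//.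
by rewrite leq_mul2r c_lt orbT.
Qed.

Lemma block_size_le N j a : (2 ^ j <= N)%N -> (block_size N j a <= 2 ^ j.+1)%N.
Proof.
move=> jN; have j0 : (0 < 2 ^ j)%N by rewrite expn_gt0.
rewrite -[leqRHS](size_iota (block N j a * 2 ^ j)) /block_size -size_filter.
apply: uniq_leq_size => [|s]; first by rewrite filter_uniq ?iota_uniq.
rewrite mem_iota mem_filter mem_iota add0n => /andP[/eqP sa /andP[_ sN]].
have q1 : (0 < N %/ 2 ^ j)%N by rewrite divn_gt0.
have := leq_divM s (2 ^ j); have := ltn_ceil s j0; have := ltn_ceil N j0.
rewrite -sa /block expnS; move: (s %/ _)%N (N %/ _)%N q1 => u q; nia.
Qed.

Lemma block_size_gt0 N j a : (2 ^ j <= N)%N -> (0 < block_size N j a)%N.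
Proof. by move=> /(@block_size_ge _ _ a); apply: leq_trans; rewrite expn_gt0. Qed.

(** * Averaging kernels and the flows between them *)

Lemma abel_sum (R : pzRingType) (n : nat) (w g : nat -> R) :
  \sum_(s < n) w s * g s =
  \sum_(x < n) (\sum_(s < x.+1) w s) * (g x - g x.+1) + (\sum_(s < n) w s) * g n.
Proof.
elim: n => [|n IH]; first by rewrite !big_ord0 mul0r addr0.
rewrite big_ord_recr/= IH [in RHS]big_ord_recr/= -!addrA; congr (_ + _).
by rewrite -mulrDr subrK big_ord_recr/= mulrDl.
Qed.

Section Kernels.
Variables (R : realFieldType) (N : nat).

Definition same_block (j a s : nat) : R := (block N j s == block N j a)%:R.

(** Transition kernel: the uniform distribution on the block of a at scale j. *)
Definition avg (j a s : nat) : R := same_block j a s / (block_size N j a)%:R.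

(** Mass crossing the edge from x to x + 1, counted from right to left, when the
    uniform distribution on the block of a at scale j + 1 is rearranged into the
    one at scale j: on a path this net flow is a difference of distribution
    functions. *)
Definition avg_flow (j a x : nat) : R :=
  \sum_(s < x.+1) (avg j a s - avg j.+1 a s).

Lemma same_block_ge0 j a s : 0 <= same_block j a s.
Proof. exact: ler0n. Qed.

Lemma avg_ge0 j a s : 0 <= avg j a s.
Proof. by rewrite divr_ge0 ?ler0n. Qed.

Lemma avg_le j a s : (2 ^ j <= N)%N -> avg j a s <= 2 ^- j * same_block j a s.
Proof.
move=> jN; rewrite mulrC ler_wpM2l ?ler0n// -natrX lef_pV2 ?posrE ?ltr0n//.
- by rewrite ler_nat block_size_ge.
- exact: block_size_gt0.
- by rewrite expn_gt0.
Qed.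

Lemma sum_same_block j a : \sum_(s < N) same_block j a s = (block_size N j a)%:R.
Proof.
rewrite /block_size -sum1_count natr_sum.
have -> : iota 0 N = index_iota 0 N by rewrite /index_iota subn0.
by rewrite big_mkord [RHS]big_mkcond; apply: eq_bigr => s _; rewrite /same_block; case: eqP.
Qed.

Lemma sum_same_block_le j s : (2 ^ j <= N)%N ->
  \sum_(a < N) same_block j a s <= 2 ^+ j.+1.
Proof.
move=> jN; rewrite (eq_bigr (fun a : 'I_N => same_block j s a)) => [|a _].
  by rewrite sum_same_block -natrX ler_nat block_size_le.
by rewrite /same_block eq_sym.
Qed.

Lemma sum_avg j a : (2 ^ j <= N)%N -> \sum_(s < N) avg j a s = 1.
Proof.
move=> jN; rewrite -mulr_suml sum_same_block mulfV// pnatr_eq0 -lt0n.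
exact: block_size_gt0.
Qed.

Lemma sum_avg_diff j a : (2 ^ j.+1 <= N)%N ->
  \sum_(s < N) (avg j a s - avg j.+1 a s) = 0.
Proof.
move=> jN; rewrite sumrB !sum_avg ?subrr//.
by rewrite (leq_trans _ jN)// leq_exp2l.
Qed.

Lemma partial_sum_avg j a x : (2 ^ j <= N)%N -> (x < N)%N ->
  0 <= \sum_(s < x.+1) avg j a s <= 1.
Proof.
move=> jN xN; rewrite sumr_ge0 => [/=|s _]; last exact: avg_ge0.
rewrite -(sum_avg a jN) (big_ord_widen N (avg j a))//.
rewrite big_mkcond/=; apply: ler_sum => s _.
by case: ifP => // _; exact: avg_ge0.
Qed.

(** Both distributions have total mass 1 and live in the block of a at scale
    j + 1.  So the distribution functions agree outside of that block, and
    elsewhere they differ by at most 1. *)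
Lemma avg_flow_le j a x : (2 ^ j.+1 <= N)%N -> (a < N)%N -> (x < N)%N ->
  `|avg_flow j a x| <= same_block j.+1 a x.
Proof.
move=> jN aN xN.
have jN' : (2 ^ j <= N)%N by rewrite (leq_trans _ jN)// leq_exp2l.
(* Both kernels vanish at points outside the block at scale j + 1. *)
have away s : (s < N)%N -> block N j.+1 s != block N j.+1 a ->
    avg j a s - avg j.+1 a s = 0.
  move=> sN neq; rewrite /avg /same_block (negPf neq) mul0r subr0.
  case: eqP => [e|_]; last by rewrite mul0r.
  by move: neq; rewrite (block_nested _ _ jN e)// eqxx.
rewrite /same_block; case: ltngtP => [lt_xa|lt_ax|_] /=.
- rewrite /avg_flow big1 ?normr0// => s _.
  have sx : (s <= x)%N by rewrite -ltnS.
  apply: away; first exact: leq_ltn_trans xN.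
  by rewrite neq_ltn (leq_ltn_trans (leq_block _ _ sx)).
- suff -> : avg_flow j a x = 0 by rewrite normr0.
  rewrite -(sum_avg_diff a jN) /avg_flow.
  rewrite (big_ord_widen N (fun s => avg j a s - avg j.+1 a s))//.
  rewrite big_mkcond; apply: eq_bigr => s _; case: ltnP => // xs.
  rewrite away// neq_ltn; apply/orP; right.
  by rewrite (leq_trans lt_ax)// leq_block// ltnW.
- rewrite /avg_flow sumrB.
  have := partial_sum_avg a jN xN; have := partial_sum_avg a jN' xN.
  by rewrite ler_norml; lra.
Qed.

(** No mass leaves [0, N): the term with x = N - 1 in avg_flowE, which refers to
    the nonexistent point N, vanishes. *)
Lemma avg_flow_last j a : (2 ^ j.+1 <= N)%N -> (0 < N)%N ->
  avg_flow j a N.-1 = 0.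
Proof. by move=> jN N0; rewrite /avg_flow prednK// sum_avg_diff. Qed.

Lemma avg_flowE j a (g : nat -> R) : (2 ^ j.+1 <= N)%N ->
  \sum_(s < N) (avg j a s - avg j.+1 a s) * g s =
  \sum_(x < N) avg_flow j a x * (g x - g x.+1).
Proof.
move=> jN.
by rewrite (abel_sum N (fun s => avg j a s - avg j.+1 a s)) sum_avg_diff// mul0r addr0.
Qed.

End Kernels.

(** A logarithmic number of scales costs a single factor k, and not k^2: the
    sum of the first j terms has l1 norm O(2^j) while h j is bounded by 2^-j, so
    adding h j increases the sum of squares by O(1) only, cross term included. *)
Lemma multiscale_sqsum_le (R : realFieldType) (V : finType) (B : R) (k : nat)
    (h : nat -> V -> R) :
  0 <= B ->
  (forall j v, (j < k)%N -> `|h j v| <= 2 ^- j) ->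
  (forall j, (j < k)%N -> \sum_v `|h j v| <= B * 2 ^+ j) ->
  \sum_v (\sum_(j < k) h j v) ^+ 2 <= 3 * B * k%:R.
Proof.
move=> B0 hmax hsum.
suff : \sum_v `|\sum_(j < k) h j v| <= B * 2 ^+ k /\
   \sum_v (\sum_(j < k) h j v) ^+ 2 <= 3 * B * k%:R by case.
elim: k hmax hsum => [|k IH] hmax hsum.
  split; first by rewrite big1 ?mulr1// => v _; rewrite big_ord0 normr0.
  by rewrite big1 ?mulr0// => v _; rewrite big_ord0 expr0n.
have [||f1 f2] := IH; [by move=> j v jk; apply: hmax; rewrite ltnS ltnW|
  by move=> j jk; apply: hsum; rewrite ltnS ltnW|].
have h1 := hsum k (ltnSn k).
split.
  apply: (@le_trans _ _ (\sum_v (`|\sum_(j < k) h j v| + `|h k v|))).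
    by apply: ler_sum => v _; rewrite big_ord_recr/= ler_normD.
  by rewrite big_split/= exprS; lra.
apply: (@le_trans _ _ (\sum_v ((\sum_(j < k) h j v) ^+ 2 +
    2 ^- k * (2 * `|\sum_(j < k) h j v| + `|h k v|)))).
  apply: ler_sum => v _; rewrite big_ord_recr/= sqrrD -addrA lerD2l.
  have hk := hmax k v (ltnSn k).
  set f := \sum_(j < k) h j v.
  apply: (@le_trans _ _ (`|h k v| * (2 * `|f| + `|h k v|))).
    rewrite mulrDr -expr2 real_normK ?num_real// lerD2r.
    rewrite mulrCA -normrM -mulr_natl ler_pM2l// (mulrC (h k v)).
    exact: ler_norm.
  by rewrite ler_wpM2r// addr_ge0// mulr_ge0.
rewrite big_split/= -mulr_sumr big_split/= -mulr_sumr -[k.+1%:R]natr1 [leRHS]mulrDr mulr1.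
apply: lerD => //.
have p0 : 0 < 2 ^+ k :> R by rewrite exprn_gt0.
rewrite mulrC ler_pdivrMr//; lra.
Qed.

(** * Multiscale unit flows on the grid *)

Section Decomposition.
Variables (R : realFieldType) (N : nat).
Hypothesis N0 : (0 < N)%N.

Local Notation same_block := (same_block R N).
Local Notation avg := (avg R N).
Local Notation avg_flow := (avg_flow R N).
Let k := trunc_log 2 N.

Let scale_le j : (j <= k)%N -> (2 ^ j <= N)%N.
Proof. by move=> jk; rewrite (leq_trans _ (trunc_logP (ltnSn 1) N0))// leq_exp2l. Qed.

(** Flow from (a, b) through the edge joining (x, y) to (x + 1, y): at each scale
    the mass is spread along the first coordinate, the second one being already
    uniform on its block at scale j.  The flow col_flow through the edges joining
    (x, y) to (x, y + 1) is the other half of each stage, when the first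
    coordinate has reached scale j + 1. *)
Definition row_flow (a b x y : nat) : R :=
  \sum_(j < trunc_log 2 N) avg_flow j a x * avg j b y.

Definition col_flow (a b x y : nat) : R :=
  \sum_(j < trunc_log 2 N) avg j.+1 a x * avg_flow j b y.

Lemma avg_finest a s : (a < N)%N -> (s < N)%N -> avg 0 a s = (s == a)%:R.
Proof.
move=> aN sN; rewrite /avg /same_block !block_finest//.
suff -> : block_size N 0 a = 1%N by rewrite divr1.
rewrite /block_size (eq_in_count (a2 := pred1 a)) => [|i]; last first.
  by rewrite mem_iota add0n => /= iN; rewrite !block_finest.
by rewrite count_uniq_mem ?iota_uniq// mem_iota add0n aN.
Qed.

Lemma avg_coarsest a s : avg k a s = N%:R^-1.
Proof.
have top := block_coarsest _ (trunc_log_ltn N (ltnSn 1)).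
rewrite /avg /same_block !top eqxx mul1r; congr (_%:R^-1).
rewrite /block_size (eq_count (a2 := predT)) ?count_predT ?size_iota// => i.
by rewrite !top eqxx.
Qed.

(** The averages A j of g over the blocks of (a, b) go from g a b at scale 0 to
    the mean over the grid at scale k.  Each difference A j - A j.+1 splits into
    an increment in the first coordinate and one in the second, and summation by
    parts turns both into increments of g along edges. *)
Lemma grid_flow_decomposition (g : nat -> nat -> R) (a b : nat) :
  (a < N)%N -> (b < N)%N ->
  g a b = N%:R^-1 * N%:R^-1 * (\sum_(x < N) \sum_(y < N) g x y) +
    (\sum_(x < N) \sum_(y < N) row_flow a b x y * (g x y - g x.+1 y) +
     \sum_(x < N) \sum_(y < N) col_flow a b x y * (g x y - g x y.+1)).
Proof.
move=> aN bN.
pose A j := \sum_(s < N) \sum_(t < N) avg j a s * avg j b t * g s t.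
have A0 : A 0%N = g a b.
  rewrite /A (bigD1 (Ordinal aN))//= [X in _ + X]big1 => [|s sa].
    rewrite addr0 (bigD1 (Ordinal bN))//= big1 => [|t tb].
      by rewrite addr0 !avg_finest// !eqxx !mul1r.
    rewrite -val_eqE/= in tb.
    by rewrite !avg_finest// (negPf tb) mulr0 mul0r.
  rewrite -val_eqE/= in sa.
  by rewrite big1// => t _; rewrite !avg_finest// (negPf sa) !mul0r.
have Ak : A k = N%:R^-1 * N%:R^-1 * (\sum_(x < N) \sum_(y < N) g x y).
  rewrite mulr_sumr; apply: eq_bigr => s _; rewrite mulr_sumr.
  by apply: eq_bigr => t _; rewrite !avg_coarsest.
have step j : (j < k)%N -> A j - A j.+1 =
    \sum_(x < N) \sum_(y < N) avg_flow j a x * avg j b y * (g x y - g x.+1 y) +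
    \sum_(x < N) \sum_(y < N) avg j.+1 a x * avg_flow j b y * (g x y - g x y.+1).
  move=> jk; have jN := scale_le jk.
  rewrite /A -sumrB.
  transitivity (\sum_(t < N) avg j b t * (\sum_(s < N) (avg j a s - avg j.+1 a s) * g s t)
     + \sum_(s < N) avg j.+1 a s * (\sum_(t < N) (avg j b t - avg j.+1 b t) * g s t)).
    under [X in _ = X + _]eq_bigr do rewrite mulr_sumr.
    rewrite [X in _ = X + _]exchange_big -big_split/=.
    apply: eq_bigr => s _; rewrite mulr_sumr -sumrB -big_split/=.
    by apply: eq_bigr => t _; ring.
  congr (_ + _).
    rewrite [RHS]exchange_big; apply: eq_bigr => t _.
    rewrite (avg_flowE a (fun s => g s t) jN) mulr_sumr.
    by apply: eq_bigr => s _; ring.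
  apply: eq_bigr => s _.
  rewrite (avg_flowE b (fun t => g s t) jN) mulr_sumr.
  by apply: eq_bigr => t _; ring.
rewrite -A0 -Ak; apply/eqP; rewrite addrC -subr_eq; apply/eqP.
transitivity (\sum_(j < k) (A j - A j.+1)).
  rewrite -opprB -(telescope_sumr A (leq0n k)) -sumrN big_mkord.
  by apply: eq_bigr => j _; rewrite opprB.
under eq_bigr => j _ do rewrite (step j (ltn_ord j)).
rewrite big_split/=.
congr (_ + _); rewrite exchange_big; apply: eq_bigr => x _.
  by rewrite exchange_big; apply: eq_bigr => y _; rewrite mulr_suml.
by rewrite exchange_big; apply: eq_bigr => y _; rewrite mulr_suml.
Qed.

Lemma row_flow_last a b y : row_flow a b N.-1 y = 0.
Proof.
by rewrite /row_flow big1// => j _; rewrite avg_flow_last ?mul0r// scale_le.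
Qed.

Lemma col_flow_last a b x : col_flow a b x N.-1 = 0.
Proof.
by rewrite /col_flow big1// => j _; rewrite avg_flow_last ?mulr0// scale_le.
Qed.

Let same_block_le1 j a s : same_block j a s <= 1.
Proof. by rewrite /same_block lern1 leq_b1. Qed.

(** Stage j carries at most 2^-j through the edge, and at most 2^(j+2) 2^(j+1)
    vertices (a, b) use it, whence the constant 8 of the l1 bound. *)
Lemma row_flow_sqsum_le x y : (x < N)%N -> (y < N)%N ->
  \sum_(a < N) \sum_(b < N) row_flow a b x y ^+ 2 <= 24 * k%:R.
Proof.
move=> xN yN.
rewrite pair_bigA/=.
have -> : 24 = 3 * 8 :> R by ring.
have bound (p : 'I_N * 'I_N) j : (j < k)%N ->
  `|avg_flow j p.1 x * avg j p.2 y| <=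
    same_block j.+1 p.1 x * (2 ^- j * same_block j p.2 y).
  move=> jk; rewrite normrM ler_pM// ?avg_flow_le ?scale_le//.
  by rewrite ger0_norm ?avg_ge0// avg_le// scale_le// ltnW.
rewrite /row_flow; apply: (@multiscale_sqsum_le _ _ 8 k
  (fun j (p : 'I_N * 'I_N) => avg_flow j p.1 x * avg j p.2 y)) => // [j p jk|j jk].
  apply: (le_trans (bound p j jk)).
  rewrite -[leRHS]mul1r; apply: ler_pM; rewrite ?same_block_le1//.
  - by rewrite mulr_ge0 ?invr_ge0 ?exprn_ge0 ?same_block_ge0.
  - by rewrite ler_piMr ?invr_ge0 ?exprn_ge0 ?same_block_le1.
apply: (le_trans (ler_sum _ (fun p _ => bound p j jk))).
rewrite -(pair_bigA _ (fun a b : 'I_N =>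
  same_block j.+1 a x * (2 ^- j * same_block j b y)))/=.
rewrite -big_distrlr/= -mulr_sumr.
have -> : 8 * 2 ^+ j = 2 ^+ j.+2 * (2 ^- j * 2 ^+ j.+1) :> R.
  by rewrite !exprS; field; rewrite expf_neq0 ?pnatr_eq0.
have jN : (2 ^ j.+1 <= N)%N by exact: scale_le.
have jN' : (2 ^ j <= N)%N by rewrite scale_le// ltnW.
apply: ler_pM.
- by apply: sumr_ge0 => a _; exact: same_block_ge0.
- rewrite mulr_ge0 ?invr_ge0 ?exprn_ge0//.
  by apply: sumr_ge0 => a _; exact: same_block_ge0.
- exact: sum_same_block_le.
- by rewrite ler_wpM2l ?invr_ge0 ?exprn_ge0// sum_same_block_le.
Qed.

Lemma col_flow_sqsum_le x y : (x < N)%N -> (y < N)%N ->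
  \sum_(a < N) \sum_(b < N) col_flow a b x y ^+ 2 <= 24 * k%:R.
Proof.
move=> xN yN.
rewrite pair_bigA/=.
have -> : 24 = 3 * 8 :> R by ring.
have bound (p : 'I_N * 'I_N) j : (j < k)%N ->
  `|avg j.+1 p.1 x * avg_flow j p.2 y| <=
    2 ^- j.+1 * same_block j.+1 p.1 x * same_block j.+1 p.2 y.
  move=> jk; rewrite normrM ler_pM// ?avg_flow_le ?scale_le//.
  by rewrite ger0_norm ?avg_ge0// avg_le// scale_le.
rewrite /col_flow; apply: (@multiscale_sqsum_le _ _ 8 k
  (fun j (p : 'I_N * 'I_N) => avg j.+1 p.1 x * avg_flow j p.2 y)) => // [j p jk|j jk].
  apply: (le_trans (bound p j jk)).
  rewrite -mulrA -[leRHS]mulr1; apply: ler_pM.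
  - by rewrite invr_ge0 exprn_ge0.
  - by rewrite mulr_ge0 ?same_block_ge0.
  - by rewrite lef_pV2 ?posrE ?exprn_gt0// ler_weXn2l// ler1n.
  - by rewrite mulr_ile1 ?same_block_ge0 ?same_block_le1.
apply: (le_trans (ler_sum _ (fun p _ => bound p j jk))).
rewrite -(pair_bigA _ (fun a b : 'I_N =>
  2 ^- j.+1 * same_block j.+1 a x * same_block j.+1 b y))/=.
rewrite -big_distrlr/= -mulr_sumr -mulrA.
have -> : 8 * 2 ^+ j = 2 ^- j.+1 * (2 ^+ j.+2 * 2 ^+ j.+2) :> R.
  by rewrite !exprS; field; rewrite expf_neq0 ?pnatr_eq0.
have jN : (2 ^ j.+1 <= N)%N by exact: scale_le.
rewrite ler_wpM2l ?invr_ge0 ?exprn_ge0//.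
apply: ler_pM; rewrite ?sum_same_block_le//.
- by apply: sumr_ge0 => a _; exact: same_block_ge0.
- by apply: sumr_ge0 => a _; exact: same_block_ge0.
Qed.

End Decomposition.

(** * From grid coordinates to the incidence matrix *)

Lemma mem_grid_edges (N : nat) (u v : 'I_(N ^ 2)) :
  ((u, v) \in grid_edges N) =
  (v == u + N :> nat)%N || ((v == u.+1 :> nat) && ((u %% N).+1 < N)%N).
Proof.
have [N0|N0] := posnP N.
  by case: u => m mN; exfalso; move: mN; rewrite N0.
rewrite inE /= /grid_adj !inE !xpair_eqE.
have := divn_eq u N; have := divn_eq v N.
have := ltn_pmod u N0; have := ltn_pmod v N0.
have := divn_eq u N; have := divn_eq v N.
move: (u %/ N)%N (u %% N)%N (v %/ N)%N (v %% N)%N => a b a' b'.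
move: (nat_of_ord u) (nat_of_ord v) => {}u {}v -> -> lb' lb _ _.
apply/andP/orP.
  case=> lt /orP[/andP[/eqP e1 /eqP e2]|/orP[/andP[/eqP e1 /eqP e2]|
    /orP[/andP[/eqP e1 /eqP e2]|/andP[/eqP e1 /eqP e2]]]].
  - exfalso; have : a = a'.+1 by lia.
    have : b = b' by lia.
    by nia.
  - left; have -> : a' = a.+1 by lia.
    have -> : b' = b by lia.
    by apply/eqP; lia.
  - by exfalso; nia.
  - right; apply/andP; split; last by lia.
    have -> : a' = a by lia.
    by apply/eqP; lia.
case=> [/eqP e|/andP[/eqP e lt]].
  have [-> ->] : a' = a.+1 /\ b' = b.
    have e' : (a' * N + b' = a.+1 * N + b)%N by lia.
    have : (a' = a.+1)%N.
      have := congr1 (fun m => m %/ N)%N e'.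
      by rewrite !divnMDl// !divn_small// !addn0.
    by move=> ?; subst a'; split => //; lia.
  by split; [lia|apply/orP; right; apply/orP; left; lia].
have [-> ->] : a' = a /\ b' = b.+1.
  have e' : (a' * N + b' = a * N + b.+1)%N by lia.
  have : (a' = a)%N.
    have := congr1 (fun m => m %/ N)%N e'.
    by rewrite !divnMDl// !divn_small// !addn0.
  by move=> ?; subst a'; split => //; lia.
split; first lia.
by apply/orP; right; apply/orP; right; apply/orP; right; lia.
Qed.

Lemma sum_grid_edges (V : nmodType) (N : nat) (F : nat -> nat -> V) :
  \sum_(e in grid_edges N) F e.1 e.2 =
  \sum_(u < N ^ 2) ((if (u + N < N ^ 2)%N then F u (u + N)%N else 0) +
                    (if ((u %% N).+1 < N)%N then F u u.+1 else 0)).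
Proof.
transitivity (\sum_(u < N ^ 2) \sum_(v < N ^ 2 | (u, v) \in grid_edges N) F u v).
  rewrite pair_big_dep/=; apply: eq_bigl => -[u v] /=.
  by [].
apply: eq_bigr => u _.
rewrite (bigID (fun v : 'I_(N ^ 2) => v == u + N :> nat)%N)/=; congr (_ + _).
  rewrite -(big_ord1_eq +%R (fun v => F u v) (u + N)).
  by apply: eq_bigl => v; rewrite mem_grid_edges; case: eqP; rewrite ?andbF.
have uN := ltn_ord u.
case: ifPn => [lt|ge]; last first.
  rewrite big1// => v; rewrite mem_grid_edges (negPf ge) andbF orbF.
  by case: eqP.
have uN2 : (u.+1 < N ^ 2)%N.
  suff : (u.+1 < N * N)%N by rewrite mulnn.
  have N0 : (0 < N)%N by lia.
  have := divn_eq u N; have : (u %/ N < N)%N by rewrite ltn_divLR// mulnn.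
  by move: (u %/ N)%N (u %% N)%N lt => a b; nia.
transitivity (\sum_(v < N ^ 2 | v == u.+1 :> nat) F u v); last first.
  by rewrite big_ord1_eq uN2.
apply: eq_bigl => v; rewrite mem_grid_edges lt andbT.
by lia.
Qed.

Lemma sum_grid_coords (V : nmodType) (N : nat) (F : nat -> nat -> V) :
  \sum_(u < N ^ 2) F (u %/ N)%N (u %% N)%N = \sum_(x < N) \sum_(y < N) F x y.
Proof.
have [->|N0] := posnP N; first by rewrite !big_ord0.
rewrite pair_bigA/=.
have lt (p : 'I_N * 'I_N) : (p.1 * N + p.2 < N ^ 2)%N.
  by case: p => -[x xN] [y yN] /=; rewrite -mulnn; nia.
have ltd (u : 'I_(N ^ 2)) : (u %/ N < N)%N by rewrite ltn_divLR// mulnn.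
rewrite (reindex (fun p => Ordinal (lt p)))/=.
  apply: eq_bigr => -[x y] _ /=.
  by rewrite divnMDl// divn_small// addn0 modnMDl modn_small.
exists (fun u => (Ordinal (ltd u), Ordinal (ltn_pmod u N0))).
  move=> [x y] _; congr pair; apply: val_inj => /=.
    by rewrite divnMDl// divn_small// addn0.
  by rewrite modnMDl modn_small.
by move=> u _; apply: val_inj => /=; rewrite -divn_eq.
Qed.

Lemma incidence_mulE (R : realType) (N : nat) (x : 'cV[R]_(N ^ 2))
    (k : 'I_#|grid_edges N|) :
  (grid_incidence R N *m x) k 0 = x (enum_val k).1 0 - x (enum_val k).2 0.
Proof.
have := enum_valP k; rewrite inE => /andP[lt _].
have neq : (enum_val k).2 != (enum_val k).1 by rewrite neq_ltn lt orbT.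
rewrite mxE (bigD1 (enum_val k).1)//= (bigD1 (enum_val k).2)//=.
rewrite !mxE eqxx (negPf neq) eqxx mul1r mulN1r big1 ?addr0// => i /andP[i1 i2].
by rewrite mxE (negPf i1) (negPf i2) mul0r.
Qed.

(** Extension by 0 to all natural numbers, so that neighbours can be written
    u + N and u + 1 without proofs that they stay in range. *)
Definition vertex_val (R : realType) (N : nat) (x : 'cV[R]_(N ^ 2)) (m : nat) : R :=
  if insub m is Some u then x u 0 else 0.

Lemma vertex_valE (R : realType) (N : nat) (x : 'cV[R]_(N ^ 2)) (u : 'I_(N ^ 2)) :
  vertex_val x u = x u 0.
Proof. by rewrite /vertex_val valK. Qed.

(** Every edge is listed at its smaller endpoint u; the other one is u + N or
    u + 1. *)
Lemma sum_edge_rows (R : realType) (N : nat) (x : 'cV[R]_(N ^ 2))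
    (F : nat -> nat -> R -> R) :
  \sum_(k < #|grid_edges N|) F (enum_val k).1 (enum_val k).2 ((grid_incidence R N *m x) k 0) =
  \sum_(u < N ^ 2)
    ((if (u + N < N ^ 2)%N
      then F u (u + N)%N (vertex_val x u - vertex_val x (u + N)) else 0) +
     (if ((u %% N).+1 < N)%N
      then F u u.+1 (vertex_val x u - vertex_val x u.+1) else 0)).
Proof.
rewrite -(sum_grid_edges N (fun u v => F u v (vertex_val x u - vertex_val x v))).
rewrite [RHS]big_enum_val; apply: eq_bigr => k _.
by rewrite incidence_mulE !vertex_valE.
Qed.

(** Row v is the unit flow from v to the uniform distribution.  An edge (u, u')
    with u' = u + N increases the first coordinate; the others increase the
    second one. *)
Definition flow_mx (R : realType) (N : nat) : 'M[R]_(N ^ 2, #|grid_edges N|) :=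
  \matrix_(v < N ^ 2, k < #|grid_edges N|)
    let u := (enum_val k).1 in
    (if (enum_val k).2 == u + N :> nat then row_flow R N else col_flow R N)%N
      (v %/ N)%N (v %% N)%N (u %/ N)%N (u %% N)%N.

Lemma flow_mx_decomposition (R : realType) (N : nat) (x : 'cV[R]_(N ^ 2)) v :
  x v 0 = (N ^ 2)%:R^-1 * (\sum_u x u 0) +
          \sum_k flow_mx R N v k * (grid_incidence R N *m x) k 0.
Proof.
have N0 : (0 < N)%N by have := ltn_ord v; case: N x v => // x v; rewrite exp0n.
pose g a b := vertex_val x (a * N + b).
have gE (u : nat) : g (u %/ N)%N (u %% N)%N = vertex_val x u.
  by rewrite /g -divn_eq.
have vN : (v %/ N < N)%N by rewrite ltn_divLR// mulnn.
rewrite -vertex_valE -gE (grid_flow_decomposition N0 g vN (ltn_pmod v N0)).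
congr (_ + _).
  rewrite -sum_grid_coords; congr (_ * _); first by rewrite -invfM -natrM mulnn.
  by apply: eq_bigr => u _; rewrite gE vertex_valE.
pose F u u' t := (if u' == u + N then row_flow R N else col_flow R N)%N
  (v %/ N)%N (v %% N)%N (u %/ N)%N (u %% N)%N * t.
transitivity (\sum_(k < #|grid_edges N|) F (enum_val k).1 (enum_val k).2
   ((grid_incidence R N *m x) k 0)); last first.
  by apply: eq_bigr => k _; rewrite [flow_mx R N v k]mxE.
rewrite sum_edge_rows -big_split/=.
transitivity (\sum_(i < N) \sum_(j < N)
    (row_flow R N (v %/ N) (v %% N) i j * (g i j - g i.+1 j) +
     col_flow R N (v %/ N) (v %% N) i j * (g i j - g i j.+1))).
  by apply: eq_bigr => i _; rewrite big_split.
rewrite -(sum_grid_coords N (fun i j =>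
    row_flow R N (v %/ N) (v %% N) i j * (g i j - g i.+1 j) +
     col_flow R N (v %/ N) (v %% N) i j * (g i j - g i j.+1))).
apply: eq_bigr => u _; congr (_ + _).
- rewrite gE; case: ifPn => [_|ge].
    rewrite /F eqxx; congr (_ * (_ - _)).
    by rewrite /g mulSn -addnA -divn_eq addnC.
  (* Without an edge below u, the flow is evaluated on the last row, where it
     vanishes. *)
  have -> : (u %/ N)%N = N.-1.
    have : (u %/ N < N)%N by rewrite ltn_divLR// mulnn.
    have : (N <= (u %/ N).+1)%N.
      have -> : (u %/ N).+1 = ((u + N) %/ N)%N by rewrite divnDr ?divnn ?N0 ?addn1.
      by rewrite leq_divRL// mulnn leqNgt.
    by lia.
  by rewrite row_flow_last// mul0r.
- rewrite gE; case: ifPn => [lt|ge].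
    have -> : g (u %/ N)%N (u %% N).+1 = vertex_val x u.+1.
      by rewrite /g addnS -divn_eq.
    rewrite /F; case: eqP => // e; exfalso; lia.
  have -> : (u %% N)%N = N.-1.
    by have := ltn_pmod u N0; lia.
  by rewrite col_flow_last// mul0r.
Qed.

Lemma flow_mx_col_sqsum_le (R : realType) (N : nat) (k : 'I_#|grid_edges N|) :
  \sum_v flow_mx R N v k ^+ 2 <= 24 * (trunc_log 2 N)%:R.
Proof.
pose u := (enum_val k).1.
have N0 : (0 < N)%N by have := ltn_ord u; move: (u : nat); case: (N).
have uN : (u %/ N < N)%N by rewrite ltn_divLR// mulnn.
have uN' := ltn_pmod u N0.
have E (f : nat -> nat -> nat -> nat -> R) :
  \sum_(v < N ^ 2) f (v %/ N)%N (v %% N)%N (u %/ N)%N (u %% N)%N ^+ 2 =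
  \sum_(a < N) \sum_(b < N) f a b (u %/ N)%N (u %% N)%N ^+ 2.
  exact: (sum_grid_coords N (fun a b => f a b (u %/ N)%N (u %% N)%N ^+ 2)).
under eq_bigr do rewrite mxE /= -/u.
case: (_ == _); rewrite E.
  exact: row_flow_sqsum_le.
exact: col_flow_sqsum_le.
Qed.

Lemma card_grid_edges_le (N : nat) : (#|grid_edges N| <= 2 * N ^ 2)%N.
Proof.
rewrite -sum1_card (sum_grid_edges N (fun _ _ => 1%N)).
apply: (@leq_trans (\sum_(u < N ^ 2) 2)%N).
  by apply: leq_sum => u _; case: ifP; case: ifP.
by rewrite sum_nat_const card_ord mulnC.
Qed.

(** By (s - t)^2 <= 2 s^2 + 2 t^2, since each vertex is twice a first and
    twice a second endpoint at most. *)
Lemma sqnorm2_incidence_le (R : realType) (N : nat) (x : 'cV[R]_(N ^ 2)) :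
  sqnorm2 (grid_incidence R N *m x) <= 8 * sqnorm2 x.
Proof.
rewrite /sqnorm2 (sum_edge_rows x (fun _ _ t => t ^+ 2)).
have shift (c : nat) : \sum_(u < N ^ 2)
    (if (u + c < N ^ 2)%N then vertex_val x (u + c) ^+ 2 else 0) <= sqnorm2 x.
  apply: (@le_trans _ _ (\sum_(u < N ^ 2)
      \sum_(w < N ^ 2 | w == (u + c)%N :> nat) x w 0 ^+ 2)).
    apply: ler_sum => u _; under [leRHS]eq_bigr do rewrite -vertex_valE.
    by rewrite (big_ord1_eq +%R (fun w => vertex_val x w ^+ 2)).
  rewrite (exchange_big_dep predT)//=; apply: ler_sum => w _.
  rewrite sumr_const -[leRHS]mulr1n ler_wpMn2l ?sqr_ge0//.
  apply/card_le1_eqP => u u'; rewrite !unfold_in => /eqP wu /eqP wu'.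
  by apply: val_inj => /=; lia.
have sq (s t : R) : (s - t) ^+ 2 <= 2 * s ^+ 2 + 2 * t ^+ 2.
  by have := sqr_ge0 (s + t); nra.
apply: (@le_trans _ _ (\sum_(u < N ^ 2) (4 * x u 0 ^+ 2 +
   (2 * (if (u + N < N ^ 2)%N then vertex_val x (u + N) ^+ 2 else 0) +
    2 * (if (u + 1 < N ^ 2)%N then vertex_val x (u + 1) ^+ 2 else 0))))).
  apply: ler_sum => u _; rewrite !vertex_valE.
  have := sq (x u 0) (vertex_val x (u + N)).
  have := sq (x u 0) (vertex_val x u.+1).
  have := sqr_ge0 (x u 0).
  have := sqr_ge0 (vertex_val x u.+1).
  rewrite addn1; case: (ltnP u.+1 (N ^ 2)) => [_|ge].
    by case: ifP => _; case: ifP => _; lra.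
  have -> : vertex_val x u.+1 = 0 by rewrite /vertex_val insubF// ltnNge ge.
  by case: ifP => _; case: ifP => _; lra.
rewrite big_split/= big_split/= -!mulr_sumr.
by have := shift N; have := shift 1%N; rewrite /sqnorm2; lra.
Qed.




(** * Independence and Gaussian tails *)

Section WeightedIntegral.
Import HBNNSimple.

(** The hypothesis says that the measure G dP, pushed forward by X, is c mu.  The
    conclusion follows on simple functions by linearity and in general by
    monotone convergence. *)
Lemma weighted_integral_comp (R : realType) (d : measure_display)
    (Omega : measurableType d) (P : {measure set Omega -> \bar R})
    (X : {mfun Omega >-> R}) (mu : {measure set R -> \bar R})
    (G : Omega -> R) (c : R) (f : R -> R) :
  0 <= c -> measurable_fun setT G -> (forall w, 0 <= G w) ->
  (forall B : set R, measurable B ->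
     (\int[P]_w (G w * \1_B (X w))%:E = c%:E * mu B)%E) ->
  measurable_fun [set: R] f -> (forall x, 0 <= f x) ->
  (\int[P]_w (G w * f (X w))%:E = c%:E * \int[mu]_x (f x)%:E)%E.
Proof.
move=> c0 mG G0 GB mf f0.
have mEf : measurable_fun [set: R] (fun x : R => (f x)%:E) by exact/measurable_EFinP.
pose h := nnsfun_approx measurableT mEf.
have simple n : (\int[P]_w (G w * h n (X w))%:E = c%:E * \int[mu]_x (h n x)%:E)%E.
  rewrite integralT_nnsfun sintegralE ge0_mule_fsumr; last first.
    by move=> r; exact: nnsfun_mulemu_ge0.
  have term r : r \in range (h n) -> (\int[P]_w (r * (G w *
      \1_(h n @^-1` [set r]) (X w)))%:E = c%:E * (r%:E * mu (h n @^-1` [set r])))%E.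
    rewrite inE => -[x _ hx].
    under eq_integral do rewrite EFinM.
    rewrite ge0_integralZl//.
    - by rewrite GB// muleCA.
    - apply/measurable_EFinP/measurable_funM => //.
      by apply: measurableT_comp => //; exact: measurable_indic.
    - by move=> w _; rewrite lee_fin mulr_ge0.
    - by rewrite lee_fin -hx.
  rewrite (eq_fsbigr _ _ (fun r hr => esym (term r hr))).
  rewrite -ge0_integral_fsum//.
  - apply: eq_integral => w _.
    rewrite (fimfunE (h n) (X w)) fsumEFin//; congr EFin.
    rewrite !fsbig_finite//= mulr_sumr.
    by apply: eq_bigr => r _; rewrite mulrCA.
  - move=> r; apply/measurable_EFinP/measurable_funM => //.
    apply: measurable_funM => //.
    by apply: measurableT_comp => //; exact: measurable_indic.
  - move=> r w _; rewrite lee_fin mulrCA mulr_ge0//.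
    exact: nnfun_muleindic_ge0 (h n) r (X w).
have cvgP : (\int[P]_w (G w * h n (X w))%:E)%E @[n --> \oo] -->
    (\int[P]_w (G w * f (X w))%:E)%E.
  have -> : (\int[P]_w (G w * f (X w))%:E =
    \int[P]_w (limn (fun n => (G w * h n (X w))%:E)))%E.
    apply: eq_integral => w _; apply/esym/cvg_lim => //.
    under eq_fun do rewrite EFinM.
    rewrite EFinM; apply: cvgeZl => //.
    by apply: (cvg_nnsfun_approx measurableT mEf) => // x _; rewrite lee_fin.
  apply: cvg_monotone_convergence => //.
  - move=> n; apply/measurable_EFinP/measurable_funM => //.
    exact: measurableT_comp.
  - by move=> n w _; rewrite lee_fin mulr_ge0.
  - move=> w _ a b ab; rewrite lee_fin ler_wpM2l//.
    exact/lefP/nd_nnsfun_approx.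
have cvgmu : (c%:E * \int[mu]_x (h n x)%:E)%E @[n --> \oo] -->
    (c%:E * \int[mu]_x (f x)%:E)%E.
  apply: cvgeZl => //.
  have -> : (\int[mu]_x (f x)%:E = \int[mu]_x limn (fun n => (h n x)%:E))%E.
    apply: eq_integral => x _; apply/esym/cvg_lim => //.
    by apply: (cvg_nnsfun_approx measurableT mEf) => // x' _; rewrite lee_fin.
  apply: cvg_monotone_convergence => //.
  - by move=> n; exact/measurable_EFinP.
  - by move=> n x _; rewrite lee_fin.
  - by move=> x _ a b ab; rewrite lee_fin; exact/lefP/nd_nnsfun_approx.
rewrite (funext simple) in cvgP.
exact: cvg_unique cvgP cvgmu.
Qed.

End WeightedIntegral.

(** Independence is the case where every f i is an indicator.  The indicators are
    replaced by the functions f i one coordinate at a time; the factors of the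
    other coordinates serve as the weight G in weighted_integral_comp. *)
Lemma independent_integral_prod (R : realType) (d : measure_display)
    (Omega : measurableType d) (P : probability Omega R) (I : finType)
    (X : I -> {RV P >-> R}) (f : I -> R -> R) (m : I -> R) :
  mutually_independent X ->
  (forall i, measurable_fun [set: R] (f i)) -> (forall i x, 0 <= f i x) ->
  (forall i, (\int[P]_w (f i (X i w))%:E)%E = (m i)%:E) ->
  (\int[P]_w (\prod_i f i (X i w))%:E)%E = (\prod_i m i)%:E.
Proof.
move=> indX mf f0 mE.
have m0 i : 0 <= m i.
  by rewrite -lee_fin -mE; apply: integral_ge0 => w _; rewrite lee_fin.
suff partial (l : seq I) : uniq l -> forall B : I -> set R,
    (forall i, measurable (B i)) ->
    (\int[P]_w (\prod_i (if i \in l then f i (X i w) else \1_(B i) (X i w)))%:E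
     = (\prod_i (if i \in l then m i else fine (P (X i @^-1` B i))))%:E)%E.
  have := partial (enum I) (enum_uniq _) (fun=> setT) (fun=> measurableT).
  rewrite (eq_bigr m) => [<-|i _]; last by rewrite mem_enum.
  apply: eq_integral => w _; congr EFin.
  by apply: eq_bigr => i _; rewrite mem_enum.
elim: l => [_ B mB|i0 l IH /= /andP[i0l ul] B mB].
  have mXB i : measurable (X i @^-1` B i) by exact: measurable_funPTI.
  transitivity (P (\bigcap_(i in [set: I]) (X i @^-1` B i))).
    have mcap : measurable (\bigcap_(i in [set: I]) (X i @^-1` B i)).
      by apply: fin_bigcap_measurable => //; exact: finite_finset.
    rewrite -[in RHS](setIT (\bigcap_(i in _) _)) -integral_indic//.
    apply: eq_integral => w _; congr EFin => /=.
    rewrite [RHS]indicE; have [wB|] := boolP (w \in _).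
      rewrite big1// => i _; rewrite indicE mem_set//.
      by move: wB; rewrite inE; apply.
    rewrite notin_setE -existsNE => -[i].
    rewrite not_implyE => -[_ XB].
    by rewrite (bigD1 i)//= indicE memNset// mul0r.
  rewrite indX// -prodEFin; apply: eq_bigr => i _.
  by rewrite fineK// fin_num_measure.
pose G w := \prod_(i | i != i0)
  (if i \in l then f i (X i w) else \1_(B i) (X i w)).
pose c := \prod_(i | i != i0)
  (if i \in l then m i else fine (P (X i @^-1` B i))).
have neq i : i != i0 -> (i \in i0 :: l) = (i \in l).
  by move=> /negPf ii0; rewrite inE ii0.
have -> : \prod_i (if i \in i0 :: l then m i else fine (P (X i @^-1` B i))) =
    c * m i0.
  rewrite (bigD1 i0)//= mem_head mulrC; congr (_ * _).
  by apply: eq_bigr => i ii0; rewrite neq.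
rewrite EFinM -mE.
have -> : (\int[P]_w (f i0 (X i0 w))%:E =
    \int[distribution P (X i0)]_x (f i0 x)%:E)%E.
  rewrite ge0_integral_distribution//; first exact/measurable_EFinP.
  by move=> x; rewrite lee_fin.
rewrite -(@weighted_integral_comp _ _ _ P (X i0) _ G)//.
- apply: eq_integral => w _; congr EFin.
  rewrite (bigD1 i0)//= mem_head mulrC; congr (_ * _).
  by apply: eq_bigr => i ii0; rewrite neq.
- by apply: prodr_ge0 => i _; case: ifP => // _; exact: fine_ge0.
- rewrite /G; under eq_fun do rewrite -big_filter.
  apply: measurable_prod => i _ /=; case: (i \in l).
    exact: measurableT_comp.
  by apply: measurableT_comp => //; exact: measurable_indic.
- by move=> w; apply: prodr_ge0 => i _; case: ifP.
move=> D mD.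
pose B' i := if i == i0 then D else B i.
have mB' i : measurable (B' i) by rewrite /B'; case: ifP.
have /(_ mB') := IH ul B'.
rewrite (bigD1 i0)//= (negPf i0l) {2}/B' eqxx mulrC => IH'.
transitivity (c * fine (P (X i0 @^-1` D)))%:E; last first.
  by rewrite EFinM fineK// fin_num_measure//; exact: measurable_funPTI.
have -> : c = \prod_(i | i != i0)
    (if i \in l then m i else fine (P (X i @^-1` B' i))).
  by apply: eq_bigr => i /negPf ii0; rewrite /B' ii0.
rewrite -IH'; apply: eq_integral => w _; congr EFin.
rewrite [in RHS](bigD1 i0)//= (negPf i0l) /B' eqxx mulrC; congr (_ * _).
by apply: eq_bigr => i /negPf ii0; rewrite ii0.
Qed.

(** Completing the square: exp(t x) times the density of N(0, sigma^2) is
    exp((t sigma)^2 / 2) times the density of N(t sigma^2, sigma^2).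

    The law is only assumed to agree with normal_prob on measurable sets, because
    the latter is defined on measurableTypeR R, whose display differs from that
    of R; the identity map between the two carries the change of variables. *)
Lemma normal_mgf (R : realType) (mu : {measure set R -> \bar R})
    (sigma t : R) : 0 < sigma ->
  (forall B : set R, measurable B -> mu B = normal_prob 0 sigma B) ->
  (\int[mu]_x (expR (t * x))%:E = (expR ((t * sigma) ^+ 2 / 2))%:E)%E.
Proof.
move=> s0 muE.
have sN0 : sigma != 0 by rewrite gt_eqF.
have mexp : measurable_fun [set: R] (fun x : R => expR (t * x)).
  by apply: measurableT_comp => //; exact: measurable_funM.
have mpdf m : measurable_fun setT (normal_pdf m sigma : measurableTypeR R -> R).
  exact: measurable_normal_pdf.
have mid : measurable_fun setT (fun x : measurableTypeR R => x : R).
  by move=> _ B mB; rewrite setTI.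
(* The identity, between two different displays on R. *)
pose idR : {mfun measurableTypeR R >-> R} :=
  HB.pack (fun x : measurableTypeR R => x : R)
    (isMeasurableFun.Build _ _ _ _ _ mid).
have := @weighted_integral_comp R _ (measurableTypeR R) lebesgue_measure idR
  mu (normal_pdf 0 sigma) 1 (fun x => expR (t * x)).
rewrite mul1e => <- //; last 2 first.
- by move=> x; exact: normal_pdf_ge0.
- move=> B mB; rewrite mul1e muE// /normal_prob [in RHS]integral_mkcond.
  apply: eq_integral => x _; rewrite patchE indicE; case: ifP => _.
    by rewrite mulr1.
  by rewrite mulr0.
transitivity (\int[lebesgue_measure]_x
    ((expR ((t * sigma) ^+ 2 / 2))%:E *
     (normal_pdf (t * sigma ^+ 2) sigma x)%:E))%E.
  apply: eq_integral => x _; rewrite -EFinM; congr EFin.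
  rewrite !normal_pdfE// mulrCA -mulrA; congr (_ * _).
  rewrite /normal_fun -!expRD; congr expR.
  have square (z : R) : - (z - 0) ^+ 2 / (sigma ^+ 2 *+ 2) + t * z =
    (t * sigma) ^+ 2 / 2 + - (z - t * sigma ^+ 2) ^+ 2 / (sigma ^+ 2 *+ 2).
    by field.
  exact: square.
rewrite ge0_integralZl//.
- by rewrite integral_normal_pdf mule1.
- apply/measurable_EFinP; exact: mpdf.
- by move=> x _; rewrite lee_fin normal_pdf_ge0.
Qed.

(** Chernoff's bound with the optimal exponent r = t / (sigma^2 V).  V is
    an upper bound and not the exact sum of squares, so that one V serves all the
    columns of a matrix. *)
Lemma gaussian_upper_tail (R : realType) (d : measure_display)
    (Omega : measurableType d) (P : probability Omega R) (I : finType)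
    (sigma : R) (X : I -> {RV P >-> R}) (a : I -> R) (V t : R) :
  0 < sigma -> isotropic_gaussian sigma X -> 0 < V -> \sum_i a i ^+ 2 <= V ->
  0 < t ->
  (P [set w | t <= \sum_i a i * X i w]%R <=
   (expR (- (t ^+ 2 / (2 * sigma ^+ 2 * V))))%:E)%E.
Proof.
move=> s0 [indX lawX] V0 aV t0.
have mS : measurable_fun [set: Omega] (fun w => \sum_i a i * X i w).
  by apply: measurable_sum => i; exact: measurable_funM.
pose S : {RV P >-> R} :=
  HB.pack (fun w => \sum_i a i * X i w) (isMeasurableFun.Build _ _ _ _ _ mS).
have [r rE] : exists r, r = t / (sigma ^+ 2 * V) by eexists.
have sV0 : 0 < sigma ^+ 2 * V by rewrite mulr_gt0// exprn_gt0.
have r0 : 0 < r by rewrite rE divr_gt0.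
have mexp i : measurable_fun [set: R] (fun x : R => expR (r * a i * x)).
  by apply: measurableT_comp => //; exact: measurable_funM.
have mgf : ('M_P S r = (\prod_i expR ((r * a i * sigma) ^+ 2 / 2))%:E)%E.
  rewrite /mmt_gen_fun unlock.
  rewrite -(@independent_integral_prod _ _ _ P _ X
    (fun i x => expR (r * a i * x)))//.
  - apply: eq_integral => w _; congr EFin.
    rewrite -expR_sum /=; congr expR; rewrite mulrC mulr_sumr.
    by apply: eq_bigr => i _; rewrite mulrA.
  - move=> i; rewrite -(normal_mgf _ s0 (lawX i)).
    rewrite ge0_integral_distribution//.
    exact/measurable_EFinP.
apply: (le_trans (chernoff S t r0)); rewrite mgf -EFinM lee_fin.
rewrite -expR_sum -expRD ler_expR.
under eq_bigr do rewrite !exprMn.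
rewrite -!mulr_suml -mulr_sumr.
have -> : - (t ^+ 2 / (2 * sigma ^+ 2 * V)) =
    r ^+ 2 * V * sigma ^+ 2 / 2 - r * t.
  by rewrite rE; field; rewrite !gt_eqF.
by rewrite lerD2r ler_pM2r// ler_pM2r ?exprn_gt0// ler_pM2l// exprn_gt0.
Qed.

Lemma with_prob_at_leastS (R : realType) (d : measure_display)
    (Omega : measurableType d) (P : probability Omega R) (p q : R)
    (E F : set Omega) :
  q <= p -> E `<=` F -> with_prob_at_least P p E -> with_prob_at_least P q F.
Proof.
move=> qp EF [A [mA AE pA]]; exists A; split => //.
  exact: subset_trans EF.
by apply: le_trans pA; rewrite lee_fin.
Qed.

Lemma with_prob_at_leastI (R : realType) (d : measure_display)
    (Omega : measurableType d) (P : probability Omega R) (p q : R)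
    (E F : set Omega) :
  with_prob_at_least P (1 - p) E -> with_prob_at_least P (1 - q) F ->
  with_prob_at_least P (1 - (p + q)) (E `&` F).
Proof.
move=> [A [mA AE pA]] [B [mB BF qB]]; exists (A `&` B); split.
- exact: measurableI.
- exact: setISS.
have mAB : measurable (A `&` B) by exact: measurableI.
rewrite -(setCK (A `&` B)) (probability_setC P (measurableC mAB)).
rewrite setCI.
have /[!(probability_setC P mA, probability_setC P mB)] :
    (P (~` A `|` ~` B) <= P (~` A) + P (~` B))%E.
  by apply: measureU2; exact: measurableC.
have mABC : measurable (~` A `|` ~` B).
  by apply: measurableU; exact: measurableC.
have finP C : measurable C -> P C = (fine (P C))%:E.
  by move=> mC; rewrite fineK// fin_num_measure.
move: pA qB; rewrite (finP A mA) (finP B mB) (finP _ mABC).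
rewrite -!EFinB -EFinD !lee_fin.
by move=> ? ? ?; lra.
Qed.

Lemma with_prob_at_least_forall (R : realType) (d : measure_display)
    (Omega : measurableType d) (P : probability Omega R) (K : finType)
    (p : K -> R) (E : K -> set Omega) :
  (forall k, with_prob_at_least P (1 - p k) (E k)) ->
  with_prob_at_least P (1 - \sum_k p k) [set w | forall k, E k w].
Proof.
move=> pE.
suff seqE (s : seq K) : with_prob_at_least P (1 - \sum_(k <- s) p k)
    [set w | forall k, k \in s -> E k w].
  apply: with_prob_at_leastS (seqE (index_enum K)) => // w sE k.
  by apply: sE; rewrite mem_index_enum.
elim: s => [|k s IH].
  exists setT; split => //.
  by rewrite probability_setT big_nil subr0.
rewrite big_cons; apply: with_prob_at_leastS (with_prob_at_leastI (pE k) IH) => //.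
by move=> w [Ek sE] j; rewrite inE => /predU1P[->//|]; exact: sE.
Qed.

Lemma gaussian_tail (R : realType) (d : measure_display)
    (Omega : measurableType d) (P : probability Omega R) (I : finType)
    (sigma : R) (X : I -> {RV P >-> R}) (a : I -> R) (V p : R) :
  0 < sigma -> isotropic_gaussian sigma X -> 0 < V -> \sum_i a i ^+ 2 <= V ->
  0 < p < 1 ->
  with_prob_at_least P (1 - 2 * p)
    [set w | (\sum_i a i * X i w) ^+ 2 <= 2 * sigma ^+ 2 * V * ln (p^-1)].
Proof.
move=> s0 gX V0 aV /andP[p0 p1].
have lp0 : 0 < ln p^-1 by rewrite ln_gt0// invf_gt1.
pose u := 2 * sigma ^+ 2 * V * ln p^-1.
have u0 : 0 < u by rewrite !mulr_gt0// exprn_gt0.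
have su0 : 0 < Num.sqrt u by rewrite sqrtr_gt0.
have one_sided (b : I -> R) : \sum_i b i ^+ 2 <= V ->
    with_prob_at_least P (1 - p) [set w | \sum_i b i * X i w <= Num.sqrt u].
  move=> bV.
  have mS : measurable_fun [set: Omega] (fun w => \sum_i b i * X i w).
    by apply: measurable_sum => i; exact: measurable_funM.
  have mB : measurable [set w | Num.sqrt u <= \sum_i b i * X i w].
    rewrite (_ : [set w | _] = (fun w => \sum_i b i * X i w) @^-1` `[Num.sqrt u, +oo[).
      by rewrite -[X in measurable X]setTI; apply: mS.
    by apply/seteqP; split => w /=; rewrite in_itv/= andbT.
  exists (~` [set w | Num.sqrt u <= \sum_i b i * X i w]); split.
  - exact: measurableC.
  - by move=> w /= /negP; rewrite -ltNge => /ltW.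
  rewrite probability_setC//.
  have := gaussian_upper_tail s0 gX V0 bV su0.
  have -> : expR (- (Num.sqrt u ^+ 2 / (2 * sigma ^+ 2 * V))) = p.
    rewrite sqr_sqrtr ?ltW// /u mulrAC mulfV ?mul1r ?lnV ?posrE// ?opprK ?lnK//.
    by rewrite !mulf_neq0 ?expf_neq0 ?gt_eqF.
  rewrite -[P [set w | _]]fineK ?fin_num_measure// -EFinB !lee_fin.
  by move=> ?; lra.
have aV' : \sum_i (- a i) ^+ 2 <= V.
  by under eq_bigr do rewrite sqrrN.
apply: with_prob_at_leastS (with_prob_at_leastI (one_sided _ aV) (one_sided _ aV')).
  by lra.
move=> w [/= le1 le2].
have le3 : - Num.sqrt u <= \sum_i a i * X i w.
  rewrite lerNl -sumrN; move: le2; congr (_ <= _).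
  by apply: eq_bigr => i _; rewrite mulNr.
rewrite -/u -(sqr_sqrtr (ltW u0)).
rewrite -subr_ge0 subr_sqr mulr_ge0 ?subr_ge0//.
by move: le3; rewrite -subr_ge0 opprK addrC.
Qed.

(** * The deterministic oracle inequality *)

(** Optimality of theta_hat against the midpoint of theta_hat and theta_bar.  The
    midpoint, rather than theta_bar itself, leaves half of
    |theta_hat - theta_bar|^2 on the left, which later absorbs the noise. *)
Lemma tv_basic_inequality (R : realType) (m n : nat) (D : 'M[R]_(m, n))
    (lambda : R) (theta eps theta_hat : 'cV[R]_n) :
  0 <= lambda ->
  argmin (tv_objective D lambda (theta + eps)) theta_hat ->
  forall theta_bar : 'cV[R]_n,
  n%:R^-1 * sqnorm2 (theta_hat - theta) +
    n%:R^-1 * (2^-1 * sqnorm2 (theta_hat - theta_bar)) <=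
  n%:R^-1 * sqnorm2 (theta_bar - theta) +
    lambda * (norm1 (D *m theta_bar) - norm1 (D *m theta_hat)) +
    n%:R^-1 * (2 * \sum_i eps i 0 * (theta_hat - theta_bar) i 0).
Proof.
move=> l0 min_hat b; set h := theta_hat in min_hat *.
have := min_hat (2^-1 *: (h + b)); rewrite /tv_objective => opt.
have n1mid : norm1 (D *m (2^-1 *: (h + b))) <=
    2^-1 * (norm1 (D *m h) + norm1 (D *m b)).
  rewrite /norm1 -big_split/= mulr_sumr; apply: ler_sum => k _.
  rewrite -scalemxAr mulmxDr !mxE normrM ger0_norm ?invr_ge0//.
  by rewrite ler_pM2l ?invr_gt0// ler_normD.
have quad : sqnorm2 (h - theta) + 2^-1 * sqnorm2 (h - b) =
    sqnorm2 (b - theta) + 2 * (\sum_i eps i 0 * (h - b) i 0) +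
    2 * (sqnorm2 (h - (theta + eps)) -
         sqnorm2 (2^-1 *: (h + b) - (theta + eps))).
  rewrite /sqnorm2 !mulr_sumr -sumrB mulr_sumr -!big_split/=.
  by apply: eq_bigr => i _; rewrite !mxE; field.
have := ler_wpM2l l0 n1mid.
rewrite -mulrDr quad; move: opt.
lra.
Qed.

(** The slack |x|^2 / 2 of the basic inequality is shared equally between the
    mean of the noise and the set T.  The constant 32 is 8 * 4: it makes the
    quadratic term produced on T at most |D x|^2 / 32 <= |x|^2 / 4. *)
Lemma tv_oracle_inequality (R : realType) (m n : nat) (D : 'M[R]_(m, n))
    (S : 'M[R]_(n, m)) (lambda tau : R) (theta eps theta_hat : 'cV[R]_n) :
  (0 < n)%N -> 0 <= lambda ->
  (forall (x : 'cV[R]_n) v, x v 0 = n%:R^-1 * (\sum_u x u 0) + \sum_k S v k * (D *m x) k 0) ->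
  (forall x : 'cV[R]_n, sqnorm2 (D *m x) <= 8 * sqnorm2 x) ->
  (forall k, (\sum_v S v k * eps v 0) ^+ 2 <= (n%:R * lambda / 2) ^+ 2) ->
  (\sum_v eps v 0) ^+ 2 <= n%:R * tau ->
  argmin (tv_objective D lambda (theta + eps)) theta_hat ->
  forall (theta_bar : 'cV[R]_n) (T : {set 'I_m}),
  n%:R^-1 * sqnorm2 (theta_hat - theta) <=
  n%:R^-1 * sqnorm2 (theta_bar - theta) +
    2 * lambda * norm1 (vrestrict (~: T) (D *m theta_bar)) +
    32 * (n%:R * lambda ^+ 2) * #|T|%:R + n%:R^-1 * (4 * tau).
Proof.
move=> n0 l0 decomp degD noiseS noise1 hat b T.
have nR : 0 < n%:R :> R by rewrite ltr0n.
have := tv_basic_inequality l0 hat b.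
set h := theta_hat; set x := h - b => basic.
have noise : 2 * (\sum_i eps i 0 * x i 0) <=
    4 * tau + 4^-1 * sqnorm2 x + n%:R * (lambda * norm1 (D *m x)).
  have -> : \sum_i eps i 0 * x i 0 =
      n%:R^-1 * (\sum_v eps v 0) * (\sum_u x u 0) +
      \sum_k (\sum_v S v k * eps v 0) * (D *m x) k 0.
    transitivity (\sum_v (eps v 0 * (n%:R^-1 * \sum_u x u 0) +
        \sum_k eps v 0 * (S v k * (D *m x) k 0))).
      by apply: eq_bigr => v _; rewrite [x v 0]decomp mulrDr mulr_sumr.
    rewrite big_split/= -mulr_suml; congr (_ + _); first by ring.
    rewrite exchange_big; apply: eq_bigr => k _; rewrite mulr_suml.
    by apply: eq_bigr => v _; ring.
  have mean : (\sum_u x u 0) ^+ 2 <= n%:R * sqnorm2 x.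
    have : 0 <= \sum_u (x u 0 - n%:R^-1 * \sum_v x v 0) ^+ 2.
      by apply: sumr_ge0 => u _; exact: sqr_ge0.
    under eq_bigr do rewrite sqrrB.
    rewrite big_split sumrB/= sumr_const card_ord.
    rewrite sumrMnl -mulr_suml -/(sqnorm2 x).
    move: (\sum_u x u 0) (sqnorm2 x) => t q.
    rewrite -(ler_pM2l nR) mulr0.
    suff -> : n%:R * (q - t * (n%:R^-1 * t) *+ 2 + (n%:R^-1 * t) ^+ 2 *+ n) =
      n%:R * q - t ^+ 2 by rewrite subr_ge0.
    by field; rewrite gt_eqF.
  have flow : 2 * (\sum_k (\sum_v S v k * eps v 0) * (D *m x) k 0) <=
      n%:R * (lambda * norm1 (D *m x)).
    rewrite /norm1 !mulr_sumr; apply: ler_sum => k _.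
    set w := \sum_v _; set z := (D *m x) k 0.
    have : `|w| <= n%:R * lambda / 2.
      rewrite -ler_sqr ?nnegrE ?normr_ge0 ?mulr_ge0 ?ler0n ?invr_ge0//.
      by rewrite real_normK ?num_real// noiseS.
    move=> /(ler_wpM2r (normr_ge0 z)); rewrite -normrM.
    by have := ler_norm (w * z); lra.
  rewrite mulrDr; apply: lerD => //.
  set s := \sum_v _ in noise1 *; set t := \sum_u _ in mean *.
  have : n%:R^-1 * (2 * s * t) <= n%:R^-1 * (4 * s ^+ 2 + 4^-1 * t ^+ 2).
    rewrite ler_pM2l ?invr_gt0//.
    by have := sqr_ge0 (2 * s - 2^-1 * t); rewrite sqrrB; lra.
  have : n%:R^-1 * (4 * s ^+ 2 + 4^-1 * t ^+ 2) <= 4 * tau + 4^-1 * sqnorm2 x.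
    rewrite mulrC ler_pdivrMr//; lra.
  by lra.
(* The penalty pays for the part of |D x|_1 outside T. *)
have cone : norm1 (D *m x) + norm1 (D *m b) - norm1 (D *m h) <=
    2 * norm1 (vrestrict T (D *m x)) + 2 * norm1 (vrestrict (~: T) (D *m b)).
  rewrite /norm1 !mulr_sumr -!big_split -sumrB /=; apply: ler_sum => k _.
  rewrite [vrestrict T _ k 0]mxE [vrestrict (~: T) _ k 0]mxE finset.in_setC.
  have -> : (D *m x) k 0 = (D *m h) k 0 - (D *m b) k 0.
    by rewrite mulmxBr !mxE.
  move: ((D *m h) k 0) ((D *m b) k 0) => p q.
  case: (k \in T) => /=; rewrite normr0.
    by have := lerB_dist q p; rewrite (distrC q p); lra.
  by have := ler_normB p q; lra.
have onT : 2 * (lambda * norm1 (vrestrict T (D *m x))) <=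
    32 * (n%:R * lambda ^+ 2) * #|T|%:R + n%:R^-1 * (4^-1 * sqnorm2 x).
  apply: (@le_trans _ _ (\sum_(k in T)
     (32 * (n%:R * lambda ^+ 2) + n%:R^-1 * (32^-1 * (D *m x) k 0 ^+ 2)))).
    rewrite /norm1 !mulr_sumr [leRHS]big_mkcond/=; apply: ler_sum => k _.
    rewrite mxE; case: ifP => _; last by rewrite normr0 !mulr0.
    set z := _ k 0; rewrite -(real_normK (num_real z)).
    (* A square: 2 lambda |z| <= 32 n lambda^2 + |z|^2 / (32 n). *)
    rewrite -subr_ge0.
    have -> : 32 * (n%:R * lambda ^+ 2) + n%:R^-1 * (32^-1 * `|z| ^+ 2) -
        2 * (lambda * `|z|) =
        n%:R^-1 * 32^-1 * (32 * (n%:R * lambda) - `|z|) ^+ 2.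
      by field; rewrite gt_eqF.
    by rewrite mulr_ge0 ?sqr_ge0 ?mulr_ge0 ?invr_ge0 ?ler0n.
  rewrite big_split/= sumr_const [_ * #|T|%:R]mulr_natr lerD2l -mulr_sumr.
  rewrite ler_pM2l ?invr_gt0// -mulr_sumr.
  have : \sum_(k in T) (D *m x) k 0 ^+ 2 <= sqnorm2 (D *m x).
    rewrite /sqnorm2 big_mkcond/=; apply: ler_sum => k _.
    by case: ifP => // _; exact: sqr_ge0.
  by have := degD x; lra.
have := ler_wpM2l l0 cone.
have : n%:R^-1 * (2 * (\sum_i eps i 0 * x i 0)) <= n%:R^-1 *
  (4 * tau + 4^-1 * sqnorm2 x + n%:R * (lambda * norm1 (D *m x))).
  by rewrite ler_pM2l ?invr_gt0.
rewrite !mulrDr mulKf ?gt_eqF//.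
lra.
Qed.

(** * Probability of the noise event *)

Lemma trunc_log_le_ln (R : realType) (N : nat) : (0 < N)%N ->
  (trunc_log 2 N)%:R <= ln ((N ^ 2)%:R : R) / (2 * ln 2).
Proof.
move=> N0; have l2 : 0 < ln (2 : R) by rewrite ln_gt0// ltr1n.
rewrite ler_pdivlMr ?mulr_gt0// natrX lnXn ?ltr0n// -[leRHS]mulr_natl.
rewrite mulrCA ler_pM2l// mulr_natl -lnXn// ler_ln ?posrE ?ltr0n ?exprn_gt0//.
by rewrite -natrX ler_nat trunc_logP.
Qed.

Lemma expR1_ge2 (R : realType) : 2 <= expR 1 :> R.
Proof. by have := expR_ge1Dx (1 : R). Qed.

Section LogBounds.
Variables (R : realType) (n delta : R).
Hypotheses (n1 : 1 <= n) (d01 : 0 < delta < 1).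
Let L := ln (expR 1 * n / delta).

Let d0 : 0 < delta. Proof. by case/andP: d01. Qed.
Let nd1 : 1 <= n / delta.
Proof.
rewrite ler_pdivlMr// mul1r (le_trans _ n1)// ltW//.
by case/andP: d01.
Qed.
Let nd0 : 0 < n / delta. Proof. exact: lt_le_trans nd1. Qed.

Lemma ln_en_deltaE : L = 1 + ln (n / delta).
Proof. by rewrite /L -mulrA lnM ?posrE ?expR_gt0// expRK. Qed.

Lemma ln_en_delta_ge1 : 1 <= L.
Proof. by rewrite ln_en_deltaE lerDl ln_ge0. Qed.

Lemma ln_le_ln_en_delta : ln n <= L.
Proof.
have n0 : 0 < n by exact: lt_le_trans n1.
rewrite ler_ln ?posrE ?mulr_gt0 ?invr_gt0 ?expR_gt0//.
rewrite ler_pdivlMr// mulrC ler_pM2r//.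
have := expR1_ge2 R; case/andP: d01; lra.
Qed.

(** delta / (4 n) is the level of each one-sided tail in the union bound over the
    at most 2 n edges. *)
Lemma ln_edge_level_le : ln ((delta / (4 * n))^-1) <= 2 * L.
Proof.
have n0 : 0 < n by exact: lt_le_trans n1.
have e0 : 0 < expR 1 * (n / delta) by rewrite mulr_gt0 ?expR_gt0.
rewrite invf_div.
have -> : 4 * n / delta = 4 * (n / delta) by rewrite mulrA.
have -> : 2 * L = ln ((expR 1 * (n / delta)) ^+ 2).
  by rewrite lnXn// mulr_natl /L mulrA.
rewrite ler_ln ?posrE ?exprn_gt0 ?[0 < 4 * _]mulr_gt0//.
rewrite exprMn; apply: ler_pM => //; first exact: ltW.
  by have := expR1_ge2 R; rewrite -[_ ^+ 2]/(_ * _); nra.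
by rewrite expr2 ler_peMr// ltW.
Qed.

Lemma ln_half_level_le : ln ((delta / 2)^-1) <= ln (expR 1 / delta).
Proof.
rewrite invf_div ler_ln ?posrE ?divr_gt0 ?expR_gt0//.
by rewrite ler_pM2r ?invr_gt0// expR1_ge2.
Qed.

Lemma ln_e_delta_le : ln (expR 1 / delta) <= L.
Proof.
rewrite ler_ln ?posrE ?divr_gt0 ?mulr_gt0 ?expR_gt0//; last first.
  exact: lt_le_trans n1.
by rewrite ler_pM2r ?invr_gt0// ler_peMr// expR_ge0.
Qed.

Lemma ln_e_delta_ge1 : 1 <= ln (expR 1 / delta).
Proof.
rewrite -[leLHS](expRK 1) ler_ln ?posrE ?divr_gt0 ?expR_gt0//.
by rewrite ler_peMr ?expR_ge0// invf_ge1// ltW//; case/andP: d01.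
Qed.
End LogBounds.

(** Each edge fails with probability at most 2 * delta / (4 n) and there are at
    most 2 n edges; the sum of the noise fails with probability at most delta.

    The value of c comes from the column bound 24 log_2 N = 12 ln n / ln 2:
    the tail level 2 sigma^2 (12 ln n / ln 2) (2 ln (e n / delta)) has to be at
    most (n lambda / 2)^2 = c^2 sigma^2 ln n ln (e n / delta) / 4. *)
Lemma noise_event (R : realType) (delta sigma : R) (N : nat)
    (d : measure_display) (Omega : measurableType d) (P : probability Omega R)
    (eps : 'I_(N ^ 2) -> {RV P >-> R}) (c lambda : R) :
  0 < delta < 1 -> (0 < N)%N -> 0 < sigma -> isotropic_gaussian sigma eps ->
  c ^+ 2 * ln 2 = 192 ->
  let n := (N ^ 2)%:R : R in
  lambda = c * sigma * Num.sqrt (ln n * ln (expR 1 * n / delta)) / n ->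
  with_prob_at_least P (1 - 2 * delta) [set w |
    (forall k, (\sum_v flow_mx R N v k * eps v w) ^+ 2 <=
        (n * lambda / 2) ^+ 2) /\
    (\sum_v eps v w) ^+ 2 <= n * (2 * sigma ^+ 2 * ln (expR 1 / delta))].
Proof.
move=> d01 N0 s0 gauss cE n lambdaE.
have /andP[d0 d1] := d01.
have n1 : 1 <= n by rewrite ler1n expn_gt0 N0.
have n0 : 0 < n by exact: lt_le_trans n1.
have l2 : 0 < ln (2 : R) by rewrite ln_gt0// ltr1n.
set L := ln (expR 1 * n / delta) in lambdaE.
have L1 : 1 <= L := ln_en_delta_ge1 n1 d01.
have lambda2 : (n * lambda / 2) ^+ 2 = c ^+ 2 / 4 * sigma ^+ 2 * (ln n * L).
  have lnn : 0 <= ln n * L by apply: mulr_ge0; [exact: ln_ge0|lra].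
  rewrite -[in RHS](sqr_sqrtr lnn) lambdaE; field.
  by rewrite pnatr_eq0 -lt0n.
pose p := delta / (4 * n).
have p01 : 0 < p < 1.
  rewrite divr_gt0 ?mulr_gt0//= ltr_pdivrMr ?mulr_gt0//; lra.
have edges (k : 'I_#|grid_edges N|) : with_prob_at_least P (1 - 2 * p)
    [set w | (\sum_v flow_mx R N v k * eps v w) ^+ 2 <= (n * lambda / 2) ^+ 2].
  (* The existence of an edge excludes N = 1, where the variance bound V is 0. *)
  have lnn : 0 < ln n.
    rewrite ln_gt0// ltr1n.
    have := enum_valP k; rewrite inE => /andP[lt _].
    by apply: leq_ltn_trans (ltn_ord (enum_val k).2); exact: leq_ltn_trans lt.
  pose V := 12 * ln n / ln 2.
  have V0 : 0 < V by rewrite divr_gt0 ?mulr_gt0.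
  have colV : \sum_v flow_mx R N v k ^+ 2 <= V.
    apply: (le_trans (flow_mx_col_sqsum_le R k)).
    have := trunc_log_le_ln R N0; rewrite -/n => tl.
    have -> : V = 24 * (ln n / (2 * ln 2)) by rewrite /V; field; rewrite gt_eqF.
    by rewrite ler_pM2l.
  have := gaussian_tail s0 gauss V0 colV p01.
  apply: with_prob_at_leastS => // w /= /le_trans; apply.
  rewrite lambda2.
  have lp := ln_edge_level_le n1 d01; rewrite -/L -/p in lp.
  apply: (@le_trans _ _ (2 * sigma ^+ 2 * V * (2 * L))).
    by apply: ler_wpM2l lp; rewrite mulr_ge0 ?(ltW V0)// mulr_ge0 ?sqr_ge0.
  have -> : c ^+ 2 = 192 / ln 2 by rewrite -cE mulfK// gt_eqF.
  rewrite /V le_eqVlt; apply/orP; left; apply/eqP; field.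
  by rewrite gt_eqF.
have total : with_prob_at_least P (1 - 2 * (delta / 2))
    [set w | (\sum_v eps v w) ^+ 2 <= n * (2 * sigma ^+ 2 * ln (expR 1 / delta))].
  have ones : \sum_(v < N ^ 2) (1 : R) ^+ 2 <= n.
    by rewrite (eq_bigr (fun=> 1)) ?sumr_const ?card_ord// => v _; rewrite expr1n.
  have h01 : 0 < delta / 2 < 1 by rewrite divr_gt0//=; lra.
  have := gaussian_tail s0 gauss n0 ones h01.
  apply: with_prob_at_leastS => // w /=.
  under eq_bigr do rewrite mul1r.
  move=> /le_trans; apply.
  rewrite [leRHS]mulrA [n * _]mulrC.
  by apply: ler_wpM2l (ln_half_level_le d01); rewrite mulr_ge0 ?(ltW n0)// mulr_ge0 ?sqr_ge0.
have := with_prob_at_leastI (with_prob_at_least_forall edges) total.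
apply: with_prob_at_leastS => [|w [e1 e2]//].
rewrite sumr_const card_ord -mulr_natr.
have cardE : (#|grid_edges N|)%:R <= 2 * n :> R.
  by rewrite -natrM ler_nat card_grid_edges_le.
have : 2 * p * #|grid_edges N|%:R <= delta.
  apply: (@le_trans _ _ (2 * p * (2 * n))).
    rewrite ler_pM2l// mulr_gt0//.
    by case/andP: p01.
  rewrite /p le_eqVlt; apply/orP; left; apply/eqP; field.
  by rewrite pnatr_eq0 -lt0n.
by lra.
Qed.
Theorem corollary5 (R : realType) :
  exists C c C' : R, [/\ 0 < C, 0 < c, 0 < C' &
  forall (delta : R) (N : nat) (sigma : R) (theta : 'cV[R]_(N ^ 2))
         (d : measure_display) (Omega : measurableType d)
         (P : probability Omega R) (eps : 'I_(N ^ 2) -> {RV P >-> R})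
         (theta_hat : Omega -> 'cV[R]_(N ^ 2)),
    0 < delta < 1 -> (0 < N)%N -> 0 < sigma ->
    isotropic_gaussian sigma eps ->
    let n := (N ^ 2)%N in
    let D := grid_incidence R N in
    let y := fun w : Omega => theta + \col_i eps i w in
    let e := expR 1 in
    let lambda :=
      c * sigma * Num.sqrt (ln n%:R * ln (e * n%:R / delta)) / n%:R in
    (forall w, argmin (tv_objective D lambda (y w)) (theta_hat w)) ->
    with_prob_at_least P (1 - 2 * delta) [set w |
      [/\ MSE (theta_hat w) theta <=
            inf [set r : R |
              exists (theta_bar : 'cV[R]_n) (T : {set 'I_#|grid_edges N|}),
                r = n%:R^-1 * sqnorm2 (theta_bar - theta)
                    + 4 * lambda * norm1 (vrestrict (~: T)%SET (D *m theta_bar))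
                    + C * sigma ^+ 2 / n%:R
                      * (#|T|%:R * ln n%:R * ln (e * n%:R / delta)
                         + ln (e / delta))],
          MSE (theta_hat w) theta <=
            C' * (Num.min (sigma * norm1 (D *m theta))
                          (sigma ^+ 2 * (norm0 (D *m theta))%:R) / n%:R
                    * ln (e * n%:R / delta) ^+ 2
                  + sigma ^+ 2 / n%:R * ln (e / delta))
        & sigma * ln (e / delta)
            <= norm1 (D *m theta) * ln (e * n%:R / delta) ^+ 2 ->
          MSE (theta_hat w) theta <=
            C' * (Num.min (sigma * norm1 (D *m theta))
                          (sigma ^+ 2 * (norm0 (D *m theta))%:R) / n%:R
                    * ln (e * n%:R / delta) ^+ 2)]]].
Proof.
have l2 : 0 < ln (2 : R) by rewrite ln_gt0// ltr1n.
pose c := Num.sqrt (192 / ln 2 : R).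
have c0 : 0 < c by rewrite sqrtr_gt0 divr_gt0.
have cE : c ^+ 2 * ln 2 = 192.
  by rewrite sqr_sqrtr ?divfK ?gt_eqF// ltW// divr_gt0.
pose C := 32 * c ^+ 2 + 8.
have C0 : 0 < C by rewrite addr_gt0// mulr_gt0// exprn_gt0.
exists C, c, (2 * (4 * c + C)); split => //.
  by rewrite mulr_gt0// addr_gt0// mulr_gt0.
move=> delta N sigma theta d Omega P eps theta_hat d01 N0 s0 gauss.
move=> n D y e lambda hat.
have /andP[d0 d1] := d01.
have n1 : 1 <= n%:R :> R by rewrite ler1n expn_gt0 N0.
have n0 : 0 < n%:R :> R by exact: lt_le_trans n1.
have L1 : 1 <= ln (e * n%:R / delta) := ln_en_delta_ge1 n1 d01.
have lnn : ln n%:R <= ln (e * n%:R / delta) := ln_le_ln_en_delta n1 d01.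
have l1 : 1 <= ln (e / delta) := ln_e_delta_ge1 d01.
have l1L : ln (e / delta) <= ln (e * n%:R / delta) := ln_e_delta_le n1 d01.
have lnn0 : 0 <= ln n%:R :> R by exact: ln_ge0.
have := noise_event d01 N0 s0 gauss cE (erefl lambda).
apply: with_prob_at_leastS => // w [noiseS noise1].
set L := ln (e * n%:R / delta) in lambda hat L1 lnn l1L noiseS *.
set l := ln (e / delta) in l1 l1L noise1 *.
have lambdaE : lambda = c * sigma * Num.sqrt (ln n%:R * L) / n%:R by [].
have L0 : 0 <= L by lra.
have l0 : 0 <= l by lra.
have lambda0 : 0 <= lambda.
  by rewrite lambdaE divr_ge0 ?(ltW n0)// mulr_ge0 ?sqrtr_ge0// mulr_ge0 ?ltW.
have nlambda2 : n%:R * lambda ^+ 2 = c ^+ 2 * sigma ^+ 2 / n%:R * (ln n%:R * L).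
  rewrite -[in RHS](sqr_sqrtr (mulr_ge0 lnn0 L0)) lambdaE; field.
  by rewrite gt_eqF.
have lambda_le : lambda <= c * sigma / n%:R * L.
  rewrite lambdaE mulrAC ler_wpM2l ?divr_ge0 ?mulr_ge0 ?(ltW c0) ?(ltW s0) ?(ltW n0)//.
  rewrite -[leRHS](ger0_norm L0) -sqrtr_sqr ler_wsqrtr// expr2.
  by rewrite ler_wpM2r.
have n_gt0 : (0 < n)%N by rewrite expn_gt0 N0.
have oracle (theta_bar : 'cV[R]_n) (T : {set 'I_#|grid_edges N|}) :
    MSE (theta_hat w) theta <= n%:R^-1 * sqnorm2 (theta_bar - theta)
      + 4 * lambda * norm1 (vrestrict (~: T)%SET (D *m theta_bar))
      + C * sigma ^+ 2 / n%:R * (#|T|%:R * ln n%:R * L + l).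
  have noiseS' k : (\sum_v flow_mx R N v k * (\col_i eps i w) v 0) ^+ 2 <=
      (n%:R * lambda / 2) ^+ 2.
    by under eq_bigr do rewrite mxE.
  have noise1' : (\sum_v (\col_i eps i w : 'cV[R]_n) v 0) ^+ 2 <=
      n%:R * (2 * sigma ^+ 2 * l).
    by under eq_bigr do rewrite mxE.
  have := tv_oracle_inequality n_gt0 lambda0 (@flow_mx_decomposition R N)
    (@sqnorm2_incidence_le R N) noiseS' noise1' (hat w) theta_bar T.
  rewrite /MSE nlambda2 => /le_trans; apply.
  set X := norm1 _.
  have X0 : 0 <= lambda * X.
    by rewrite mulr_ge0// sumr_ge0.
  have : 0 <= sigma ^+ 2 / n%:R * (8 * (#|T|%:R * (ln n%:R * L)) + 32 * c ^+ 2 * l).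
    apply: mulr_ge0; first by rewrite divr_ge0 ?sqr_ge0 ?(ltW n0).
    apply: addr_ge0; first by rewrite !mulr_ge0.
    by rewrite mulr_ge0// mulr_ge0// sqr_ge0.
  rewrite /C; lra.
have sn0 : 0 <= sigma ^+ 2 / n%:R by rewrite divr_ge0 ?sqr_ge0 ?(ltW n0).
pose B := Num.min (sigma * norm1 (D *m theta))
  (sigma ^+ 2 * (norm0 (D *m theta))%:R).
have LL : L <= L ^+ 2 by rewrite expr2 ler_peMl.
(* The oracle inequality at theta, with T empty when the l1 rate is the smaller
   one and T the support of D theta otherwise. *)
have slow : MSE (theta_hat w) theta <=
    (4 * c + C) * (B / n%:R * L ^+ 2 + sigma ^+ 2 / n%:R * l).
  have self0 : n%:R^-1 * sqnorm2 (theta - theta) = 0.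
    by rewrite subrr /sqnorm2 big1 ?mulr0// => i _; rewrite mxE expr0n.
  rewrite /B minEle; case: ifP => _.
  - have := oracle theta finset.set0.
    rewrite self0 add0r cards0 !mul0r add0r finset.setC0.
    have -> : norm1 (vrestrict [set: _]%SET (D *m theta)) = norm1 (D *m theta).
      by rewrite /norm1; apply: eq_bigr => k _; rewrite mxE inE.
    move=> /le_trans; apply.
    set X := norm1 _.
    have X0 : 0 <= X by apply: sumr_ge0.
    have sXn0 : 0 <= sigma * X / n%:R.
      by rewrite divr_ge0 ?(ltW n0)// mulr_ge0 ?(ltW s0).
    have tv_part : lambda * X <= c * (sigma * X / n%:R * L ^+ 2).
      apply: (le_trans (ler_wpM2r X0 lambda_le)).
      have -> : c * sigma / n%:R * L * X = c * (sigma * X / n%:R * L) by ring.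
      by rewrite ler_wpM2l ?(ltW c0)// ler_wpM2l.
    have : 0 <= C * (sigma * X / n%:R * L ^+ 2).
      by rewrite mulr_ge0 ?(ltW C0)// mulr_ge0 ?sqr_ge0.
    have : 0 <= c * (sigma ^+ 2 / n%:R * l).
      by rewrite mulr_ge0 ?(ltW c0)// mulr_ge0.
    lra.
  - pose T := [set k | (D *m theta) k 0 != 0]%SET.
    have := oracle theta T.
    have -> : norm1 (vrestrict (~: T)%SET (D *m theta)) = 0.
      rewrite /norm1 big1// => k _; rewrite mxE !inE negbK.
      by case: eqP => [->|_]; rewrite normr0.
    rewrite self0 mulr0 !add0r => /le_trans; apply.
    rewrite (_ : #|T| = norm0 (D *m theta))//.
    set K := (norm0 _)%:R.
    have K0 : 0 <= K by exact: ler0n.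
    have sparse : C * (sigma ^+ 2 / n%:R) * (K * (ln n%:R * L)) <=
        C * (sigma ^+ 2 / n%:R) * (K * L ^+ 2).
      apply: ler_wpM2l; first by rewrite mulr_ge0 ?(ltW C0).
      by rewrite ler_wpM2l// expr2 ler_wpM2r.
    have : 0 <= c * (sigma ^+ 2 / n%:R * (K * L ^+ 2)).
      by rewrite mulr_ge0 ?(ltW c0)// mulr_ge0// mulr_ge0 ?sqr_ge0.
    have : 0 <= c * (sigma ^+ 2 / n%:R * l).
      by rewrite mulr_ge0 ?(ltW c0)// mulr_ge0.
    lra.
have B0 : 0 <= B.
  by rewrite le_min !mulr_ge0 ?sqr_ge0 ?(ltW s0) ?ler0n// sumr_ge0.
have cC0 : 0 <= 4 * c + C by rewrite addr_ge0 ?(ltW C0)// mulr_ge0 ?(ltW c0).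
have BL0 : 0 <= B / n%:R * L ^+ 2.
  by rewrite mulr_ge0 ?sqr_ge0// divr_ge0 ?(ltW n0).
have ql0 : 0 <= sigma ^+ 2 / n%:R * l by rewrite mulr_ge0.
split.
- apply: lb_le_inf.
    by eexists; exists theta, finset.set0; reflexivity.
  by move=> _ [theta_bar [T ->]]; exact: oracle.
- apply: (le_trans slow); rewrite -/B.
  by have := mulr_ge0 cC0 (addr_ge0 BL0 ql0); lra.
- move=> large; apply: (le_trans slow).
  rewrite -/B.
  suff small : sigma ^+ 2 / n%:R * l <= B / n%:R * L ^+ 2.
    by have := ler_wpM2l cC0 small; lra.
  have -> : sigma ^+ 2 / n%:R * l = sigma ^+ 2 * l / n%:R by rewrite mulrAC.
  rewrite [leRHS]mulrAC ler_wpM2r ?invr_ge0 ?(ltW n0)// /B minEle.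
  case: ifP => _.
    by rewrite expr2 -!mulrA ler_wpM2l ?(ltW s0).
  rewrite -[leRHS]mulrA ler_wpM2l ?sqr_ge0//.
  (* If D theta vanished, the assumption would read sigma * l <= 0. *)
  have K1 : 1 <= (norm0 (D *m theta))%:R :> R.
    rewrite ler1n lt0n; apply/eqP => norm00.
    have D0 : norm1 (D *m theta) = 0.
      rewrite /norm1 big1// => k _; apply/eqP; rewrite normr_eq0.
      move/cards0_eq/setP: norm00 => /(_ k); rewrite !inE.
      by move/negbFE.
    move: large; rewrite D0 mul0r leNgt => /negP; apply.
    by rewrite mulr_gt0//; lra.
  have : L ^+ 2 <= (norm0 (D *m theta))%:R * L ^+ 2.
    by rewrite ler_peMl ?sqr_ge0.
  lra.
Qed.
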